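(* Let $M\subset S^{n+1}$ be a closed, connected, strictly convex hypersurface of class $C^{m,\alpha}$, $m\ge 2$, $0\le\alpha\le 1$. Then $\tilde M\subset S^{n+1}$, its image under the Gauss map, is also of class $C^{m,\alpha}$.
   Context: $S^{n+1}$ is the unit sphere in $\mathbb R^{n+2}$. A closed connected hypersurface $M\subset S^{n+1}$ is strictly convex if its second fundamental form with respect to the interior normal is positive definite; then $M$ is embedded, contained in an open hemisphere, and bounds a convex body $\hat M\subset S^{n+1}$. The Gauss map of $M$ assigns to $x\in M$ the exterior unit normal $\tilde x=\nu\in T_x(S^{n+1})\subset\mathbb R^{n+2}$ of $M$ at $x$, regarded as a point of $S^{n+1}$. ''Of class $C^{m,\alpha}$'' refers to $\tilde M$ as a hypersurface (submanifold) of $S^{n+1}$. *)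

(* Defs.v *)
From HB Require Import structures.
From mathcomp Require Import all_boot all_order all_algebra.
From mathcomp Require Import all_classical all_reals all_analysis.

Set Implicit Arguments.
Unset Strict Implicit.
Unset Printing Implicit Defensive.

Import Order.TTheory GRing.Theory Num.Theory.
Import numFieldNormedType.Exports.

Local Open Scope classical_set_scope.
Local Open Scope ring_scope.

Definition dot (R : realType) (N : nat) (x y : 'rV[R]_N) : R :=
  \sum_(i < N) x 0 i * y 0 i.

(* The sphere S^(n+1) is [unit_sphere R n.+2]. *)
Definition unit_sphere (R : realType) (N : nat) : set 'rV[R]_N :=
  [set x | dot x x = 1].

(* Local Hoelder continuity.  For a = 0 the bound reads |f y - f z| <= C
   (powR _ 0 = 1), i.e. local boundedness, so that C^{m,0} below is C^m. *)
Definition locally_holder (R : realType) (N P : nat) (a : R)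
    (U : set 'rV[R]_N) (f : 'rV[R]_N -> 'rV[R]_P) : Prop :=
  forall x, U x -> exists C : R,
    \forall y \near x & z \near x, `|f y - f z| <= C * (`|y - z| `^ a).

(* f is of class C^{m,a} on the open set U: m times continuously
   differentiable, with derivatives of order m locally a-Hoelder. *)
Fixpoint class_C (R : realType) (N P : nat) (m : nat) (a : R)
    (U : set 'rV[R]_N) (f : 'rV[R]_N -> 'rV[R]_P) : Prop :=
  (forall x, U x -> {for x, continuous f}) /\
  if m is k.+1 then
    (forall x, U x -> differentiable f x) /\
    (forall v : 'rV[R]_N, class_C k a U ('D_v f))
  else locally_holder a U f.

(* phi is a homeomorphism of U onto a relatively open subset of M. *)
Definition homeo_onto_open (R : realType) (N P : nat) (M : set 'rV[R]_P)
    (U : set 'rV[R]_N) (phi : 'rV[R]_N -> 'rV[R]_P) : Prop :=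
  exists (V : set 'rV[R]_P) (psi : 'rV[R]_P -> 'rV[R]_N),
    [/\ open V, phi @` U = M `&` V, {within U, continuous phi},
        {within M `&` V, continuous psi} &
        forall u, U u -> psi (phi u) = u].

Definition chart (R : realType) (N P : nat) (m : nat) (a : R)
    (M : set 'rV[R]_P) (U : set 'rV[R]_N) (phi : 'rV[R]_N -> 'rV[R]_P) : Prop :=
  [/\ open U, class_C m a U phi,
      forall u, U u -> injective ('d phi u) & homeo_onto_open M U phi].

(* M is an (embedded) n-dimensional submanifold of S^(n+1) of class C^{m,a}. *)
Definition hypersurface (R : realType) (n m : nat) (a : R)
    (M : set 'rV[R]_n.+2) : Prop :=
  M `<=` unit_sphere (N := n.+2) /\
  forall x, M x -> exists (U : set 'rV[R]_n) (phi : 'rV[R]_n -> 'rV[R]_n.+2),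
    chart m a M U phi /\ (phi @` U) x.

Definition tangent (R : realType) (n m : nat) (a : R) (M : set 'rV[R]_n.+2)
    (x : 'rV[R]_n.+2) : set 'rV[R]_n.+2 :=
  [set w | exists (U : set 'rV[R]_n) (phi : 'rV[R]_n -> 'rV[R]_n.+2)
                  (u v : 'rV[R]_n),
     [/\ chart m a M U phi, U u, phi u = x & w = 'd phi u v]].

Definition unit_normal (R : realType) (n m : nat) (a : R)
    (M : set 'rV[R]_n.+2) (x nu : 'rV[R]_n.+2) : Prop :=
  [/\ dot nu nu = 1, dot nu x = 0 &
      forall w, tangent m a M x w -> dot nu w = 0].

(* Om is one of the two sides of M in the sphere. *)
Definition side (R : realType) (n : nat) (M Om : set 'rV[R]_n.+2) : Prop :=
  exists2 y, (unit_sphere (N := n.+2) `\` M) y &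
    Om = connected_component (unit_sphere (N := n.+2) `\` M) y.

(* nu is, on M, the Gauss map of M relative to the interior Om: the unit normal
   field pointing out of Om, while - nu (the interior normal) points into Om.
   Here t |-> cos t x +- sin t nu(x) are the great circles normal to M at x.
   The values of nu off M are irrelevant. *)
Definition gauss_map (R : realType) (n m : nat) (a : R)
    (M Om : set 'rV[R]_n.+2) (nu : 'rV[R]_n.+2 -> 'rV[R]_n.+2) : Prop :=
  forall x, M x ->
    [/\ unit_normal m a M x (nu x),
        \forall t \near (0 : R)^'+, Om (cos t *: x - sin t *: nu x) &
        \forall t \near (0 : R)^'+, ~ Om (cos t *: x + sin t *: nu x)].

(* Second fundamental form with respect to the unit normal e, in the chart phi.
   The normal component in the sphere of the second derivative of phi is its
   e-component, as the position vector is orthogonal to e. *)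
Definition second_form (R : realType) (n : nat)
    (phi : 'rV[R]_n -> 'rV[R]_n.+2) (e : 'rV[R]_n.+2) (u v w : 'rV[R]_n) : R :=
  dot ('D_v ('D_w phi) u) e.

(* The second fundamental form of M with respect to the unit normal field e is
   positive definite. *)
Definition second_form_posdef (R : realType) (n m : nat) (a : R)
    (M : set 'rV[R]_n.+2) (e : 'rV[R]_n.+2 -> 'rV[R]_n.+2) : Prop :=
  forall (U : set 'rV[R]_n) (phi : 'rV[R]_n -> 'rV[R]_n.+2),
    chart m a M U phi ->
    forall u v, U u -> v != 0 -> 0 < second_form phi (e (phi u)) u v v.

(* Main.v *)
(** The normal is the solution of a linear system in the first derivatives of a
    chart, so the Gauss map N, read in a chart, is only of class C^{m-1,a}.  The
    derivative is regained by duality.  Differentiating <N, phi> = 0 shows that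
    the position vector phi is a normal of the image; positive definiteness of the
    second fundamental form makes the orthogonal projection of N to the tangent
    space at a point a local diffeomorphism, hence the image is parametrised by
    Phi = N o H over that tangent space, with H a local inverse of class C^{m-1,a}.
    The derivative of Phi is determined by a linear system whose coefficients are
    phi o H and Phi; it is therefore of class C^{m-1,a}, and Phi of class C^{m,a}.

    That the image is embedded requires the Gauss map to be injective.  This is a
    Tietze-Nakajima argument in the cone over the sphere: locally the interior is
    the intersection of the supporting half-spaces, so for an interior point p with
    -p outside M, the points of M visible from p form an open and closed set, hence
    all of M.  Letting p tend to M, each tangent hyperplane supports all of M, and
    strict local convexity separates points with the same normal. *)

Require Import Defs.
From HB Require Import structures.
From mathcomp Require Import all_boot all_order all_algebra.
From mathcomp Require Import all_classical all_reals all_analysis.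
Import Order.TTheory GRing.Theory Num.Theory.
Import numFieldNormedType.Exports.
Local Open Scope classical_set_scope.
Local Open Scope ring_scope.
From mathcomp Require Import ring lra.

(** * Functions of class C^(k,a) *)

Section DiffIntro.
Context {R : realType} {V W : normedModType R}.

(** No regularity of [nu] is assumed: it is only a choice of unit normal at each point. Even its
    continuity has to be deduced, and definiteness of the second fundamental form does it by
    singling out one of the two unit normals. For [n] = 0 that form says nothing, but a connected
    [M] then has at most one point. A hemisphere containing [M] is not given either. This explains
    the condition on -p: a segment from p to a point of [M] may not pass through 0, the one point of
    the cone without projection to the sphere. The regained derivative depends on the choice of
    parameter. Over a fixed tangent space Phi is a section of a linear projection, so its derivative
    has constant products with a fixed tangent basis; the remaining coefficients, position and
    normal, are undifferentiated. Hoelder exponents survive inversion and composition because the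
    inner maps are locally Lipschitz. Finally, an injective Gauss map is not yet an embedding:
    compactness of [M] is what makes the image of a small chart relatively open. *)

Lemma differentiable_intro (f : V -> W) (L : {linear V -> W}) (x : V) :
  continuous L ->
  (forall e, 0 < e -> \forall h \near (0 : V),
     `|f (h + x) - f x - L h| <= e * `|h|) ->
  differentiable f x /\ 'd f x = L :> (V -> W).
Proof.
move=> Lc fL.
have E : f \o shift x = cst (f x) + L +o_ 0 id.
  apply/eqaddoP => e e0; have := fL e e0; apply: filterS => h.
  by rewrite /= opprD addrA.
have dE := diff_unique Lc E.
by split => //; apply/diff_locallyP; rewrite dE.
Qed.

Lemma near_eq_differentiable (f g : V -> W) x :
  {near x, f =1 g} -> differentiable f x -> differentiable g x.
Proof.
move=> fg df; have [dc /eqaddoP dE] := (diff_locallyP _ _).1 df.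
have [//|e e0|] := @differentiable_intro g ('d f x) x; last by [].
have := dE e e0; apply: filter_app.
have : \forall h \near (0 : V), f (h + x) = g (h + x).
  by move: fg; rewrite (near_shift 0 x) subr0; apply: filterS => h.
apply: filterS => h; rewrite -(nbhs_singleton fg) => <- /=.
by rewrite opprD addrA.
Qed.

End DiffIntro.

Section Calculus.
Context {R : realType}.

Lemma near_ballP {V : normedModType R} (x : V) (P : V -> Prop) :
  (\forall y \near x, P y) <->
  exists2 d : R, 0 < d & forall y, `|y - x| < d -> P y.
Proof.
split=> [/nbhs_normP[d d0 H]|[d d0 H]].
  by exists d => // y yx; apply: H; rewrite /= distrC.
by apply/nbhs_normP; exists d => // y; rewrite /= distrC; exact: H.
Qed.

Lemma near2_ballP {V : normedModType R} (x : V) (P : V -> V -> Prop) :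
  (\forall y \near x & z \near x, P y z) <->
  exists2 d : R, 0 < d & forall y z, `|y - x| < d -> `|z - x| < d -> P y z.
Proof.
split=> [[[A B] /= [/near_ballP[d d0 Ad] /near_ballP[d' d'0 Bd]] H]|[d d0 H]].
  exists (Num.min d d'); first by rewrite lt_min d0.
  move=> y z; rewrite !lt_min => /andP[/Ad Ay _] /andP[_ /Bd Bz].
  exact: (H (y, z)).
exists ([set y | `|y - x| < d], [set y | `|y - x| < d]) => /=.
  by split; apply/near_ballP; exists d.
by move=> [y z] /= [yd zd]; exact: H.
Qed.

Lemma open_ballP {V : normedModType R} {U : set V} {x} : open U -> U x ->
  exists2 d : R, 0 < d & forall y, `|y - x| < d -> U y.
Proof. by move=> Uo Ux; apply/near_ballP; exact: open_nbhs_nbhs. Qed.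

(* [class_C] for scalar functions: the class of a vector-valued function is that of
   its coordinates, see [class_CP]. *)
Fixpoint Ck {N : nat} (k : nat) (a : R) (U : set 'rV[R]_N) (f : 'rV[R]_N -> R)
    : Prop :=
  (forall x, U x -> {for x, continuous f}) /\
  if k is j.+1 then
    (forall x, U x -> differentiable f x) /\
    (forall v : 'rV[R]_N, Ck j a U ('D_v f))
  else forall x, U x -> exists C : R,
    \forall y \near x & z \near x, `|f y - f z| <= C * (`|y - z| `^ a).

Lemma near_eq_on {T : topologicalType} {S : Type} {U : set T} {h h' : T -> S} x :
  open U -> U x -> (forall x, U x -> h x = h' x) -> {near x, h =1 h'}.
Proof.
by move=> Uo Ux hh'; near=> y; apply: hh'; near: y; exact: open_nbhs_nbhs.
Unshelve. all: by end_near. Qed.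

Lemma near_eq_continuous {T S : topologicalType} {h h' : T -> S} x :
  {near x, h =1 h'} -> {for x, continuous h} -> {for x, continuous h'}.
Proof.
move=> hh' ch; rewrite /prop_for /continuous_at -(nbhs_singleton hh').
apply: cvg_trans ch; exact: near_eq_cvg.
Qed.

(** Openness of [U] upgrades equality on [U] to equality near each of its points, so that the
    derivatives agree as well. *)
Lemma Ck_ext {N k a} {U : set 'rV[R]_N} f g : open U ->
  (forall x, U x -> f x = g x) -> Ck k a U f -> Ck k a U g.
Proof.
move=> Uo; elim: k f g => [|k IH] f g fg /= [cf].
  move=> hf; split=> [x Ux|x Ux].
    by apply: near_eq_continuous (cf x Ux); apply: near_eq_on fg.
  have [C /near2_ballP[d d0 hC]] := hf _ Ux; exists C.
  have [d' d'0 hU] := open_ballP Uo Ux.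
  apply/near2_ballP; exists (Num.min d d'); first by rewrite lt_min d0.
  by move=> y z; rewrite !lt_min => /andP[yd /hU Uy] /andP[zd /hU Uz]; rewrite -!fg//; exact: hC.
move=> [df Df]; split=> [x Ux|].
  by apply: near_eq_continuous (cf x Ux); apply: near_eq_on fg.
split=> [x Ux|v].
  by apply: near_eq_differentiable (df x Ux); apply: near_eq_on fg.
by apply: (IH ('D_v f)) => // x Ux; apply: near_eq_derive; exact: near_eq_on fg.
Unshelve. all: by end_near. Qed.

Lemma Ck_sub {N k a} {U U' : set 'rV[R]_N} f :
  U' `<=` U -> Ck k a U f -> Ck k a U' f.
Proof.
move=> UU'; elim: k f => [|k IH] f /= [cf].
  by move=> hf; split=> x /UU'; [exact: cf|exact: hf].
move=> [df Df]; split=> [x /UU'|]; first exact: cf.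
by split=> [x /UU'|v]; [exact: df|exact: IH].
Qed.

Lemma Ck_cont {N k a} {U : set 'rV[R]_N} {f} {x} : Ck k a U f -> U x -> {for x, continuous f}.
Proof. by case: k => [|k] [cf _] /cf. Qed.

Lemma Ck_diff {N k a} {U : set 'rV[R]_N} {f} {x} : Ck k.+1 a U f -> U x -> differentiable f x.
Proof. by move=> [_ [df _]] /df. Qed.

Lemma Ck_D {N k a} {U : set 'rV[R]_N} {f} v : Ck k.+1 a U f -> Ck k a U ('D_v f).
Proof. by move=> [_ [_ +]]; exact. Qed.

Lemma Ck_succ {N k a} {U : set 'rV[R]_N} f :
  (forall x, U x -> differentiable f x) -> (forall v, Ck k a U ('D_v f)) ->
  Ck k.+1 a U f.
Proof.
by move=> df Df; split => // x Ux; apply: differentiable_continuous; exact: df.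
Qed.

Lemma row_continuousP {T : topologicalType} {n : nat} (f : T -> 'rV[R]_n) x :
  {for x, continuous f} <-> forall i, {for x, continuous (fun y => f y 0 i)}.
Proof.
split=> [cf i|cf].
  exact: (@continuous_comp _ _ _ f (fun M : 'rV[R]_n => M 0 i)
    _ cf (@coord_continuous _ _ _ 0 i _)).
apply/cvgrPdist_le => /= e e0.
near=> y.
rewrite /Num.Def.normr/= mx_normrE (bigmax_le _ (ltW e0))//= => i _.
rewrite !mxE/= [i.1]ord1.
move: i; near: y; apply: filter_forall => /= i.
exact: ((cvgrPdist_le _ _).1 (cf i.2)).
Unshelve. all: by end_near. Qed.

Lemma norm_coord_le {n} (x : 'rV[R]_n) i : `|x 0 i| <= `|x|.
Proof.
rewrite [leRHS]/Num.Def.normr/= mx_normrE; exact: (le_bigmax _ (fun i : 'I_1 * 'I_n =>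
  `|x i.1 i.2|) (0, i)).
Qed.

Lemma norm_row_le {n} (x : 'rV[R]_n) c : 0 <= c -> (forall i, `|x 0 i| <= c) -> `|x| <= c.
Proof.
move=> c0 H; rewrite /Num.Def.normr/= mx_normrE (bigmax_le _ c0)//= => i _.
by rewrite [i.1]ord1.
Qed.

Lemma row_differentiableP {V : normedModType R} {n : nat} (f : V -> 'rV[R]_n) x :
  differentiable f x <-> forall i, differentiable (fun y => f y 0 i) x.
Proof.
split=> [df i|df].
  exact: (@differentiable_comp _ _ _ _ f (fun M : 'rV[R]_n => M 0 i)
    _ df (differentiable_coord _ _ _)).
have -> : f = \sum_(i < n) (fun y => f y 0 i *: delta_mx 0 i).
  by apply/funext => y; rewrite fct_sumE; exact: row_sum_delta.
by apply: differentiable_sum => i; apply: differentiableZl; exact: df.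
Qed.

Lemma derive_row {V : normedModType R} {n : nat} (f : V -> 'rV[R]_n) x v i :
  differentiable f x -> ('D_v f x) 0 i = 'D_v (fun y => f y 0 i) x.
Proof. by move=> /diff_derivable-/(_ v) df; rewrite derive_mx// mxE. Qed.

Lemma class_CP {N P m a} {U : set 'rV[R]_N} (f : 'rV[R]_N -> 'rV[R]_P) : open U ->
  class_C m a U f <-> forall i, Ck m a U (fun x => f x 0 i).
Proof.
move=> Uo; elim: m f => [|m IH] f /=.
  split=> [[cf hf] i|H].
    split=> x Ux; first exact: (row_continuousP f x).1 (cf x Ux) i.
    have [C hC] := hf x Ux; exists C; move: hC => /near2_ballP[d d0 hC].
    apply/near2_ballP; exists d => // y z yd zd.
    by apply: le_trans (hC y z yd zd); apply: le_trans (norm_coord_le _ i); rewrite !mxE.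
  split=> x Ux; first by apply/row_continuousP => i; exact: (H i).1.
  (* Validity for all small radii, rather than for one, lets the finitely many coordinates share a
     radius. *)
  have hC i : exists C, \forall d \near 0^'+, forall y z, `|y - x| < d -> `|z - x| < d ->
      `|f y 0 i - f z 0 i| <= C * `|y - z| `^ a.
    have [C /near2_ballP[d d0 hC]] := (H i).2 x Ux; exists C.
    near=> e => y z yd zd.
    by apply: hC; [apply: lt_le_trans yd _|apply: lt_le_trans zd _]; near: e; exact: nbhs_right_le.
  have {}hC i := cid (hC i).
  exists (\sum_i `|sval (hC i)|); apply/near2_ballP.
  near (0 : R)^'+ => d; exists d => // y z yd zd.
  apply: norm_row_le => [|i]; first by rewrite mulr_ge0 ?powR_ge0// sumr_ge0.
  rewrite !mxE; apply: (@le_trans _ _ (sval (hC i) * `|y - z| `^ a)).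
    move: i y z yd zd; near: d; apply: filter_forall => i; exact: svalP (hC i).
  rewrite ler_wpM2r ?powR_ge0// (le_trans (ler_norm _))// (bigD1 i)//= lerDl sumr_ge0//.
split=> [[cf [df Df]] i|H].
  split=> [x Ux|]; first exact: (row_continuousP f x).1 (cf x Ux) i.
  split=> [x Ux|v]; first exact: (row_differentiableP f x).1 (df x Ux) i.
  have := (IH _).1 (Df v) i; apply: Ck_ext => // x Ux.
  by rewrite derive_row//; exact: df.
have df x : U x -> differentiable f x.
  by move=> Ux; apply/row_differentiableP => i; exact: Ck_diff (H i) Ux.
split=> [x Ux|]; first exact/differentiable_continuous/df.
split=> // v; apply/IH => i; have := Ck_D v (H i); apply: Ck_ext => // x Ux.
by rewrite derive_row//; exact: df.
Unshelve. all: by end_near. Qed.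
End Calculus.

(** * Closure of the classes under algebraic operations and composition *)

Section Algebra.
Context {R : realType}.

Lemma derive_basis {N} (f : 'rV[R]_N -> R) x v : differentiable f x ->
  'D_v f x = \sum_i v 0 i * 'D_(delta_mx 0 i) f x.
Proof.
move=> df; rewrite deriveE// {1}(row_sum_delta v) linear_sum.
by apply: eq_bigr => i _; rewrite linearZ deriveE.
Qed.

Lemma is_derive_line {N} (f : 'rV[R]_N -> R) z v (t : R) :
  differentiable f (z + t *: v) ->
  is_derive t 1 (fun s : R => f (z + s *: v)) ('D_v f (z + t *: v)).
Proof.
move=> df.
have dl : is_diff t (fun s : R => z + s *: v) (fun s => s *: v).
  have := is_diffD (is_diff_cst z t) (is_diff_scalel t v).
  by rewrite add0r.
have dfl := is_diff_comp dl (differentiableP df).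
split; first exact/diff_derivable/ex_diff.
by rewrite deriveE ?diff_val //= scale1r deriveE.
Qed.

Lemma MVT_line {N} (f : 'rV[R]_N -> R) z v :
  (forall t : R, 0 <= t <= 1 -> differentiable f (z + t *: v)) ->
  exists2 t : R, 0 < t < 1 & f (z + v) - f z = 'D_v f (z + t *: v).
Proof.
move=> df.
have D (t : R) : 0 <= t <= 1 -> is_derive t 1 (fun s : R => f (z + s *: v)) ('D_v f (z + t *: v)).
  by move=> t01; apply/is_derive_line/df.
have [||t] := @MVT R (fun s => f (z + s *: v)) (fun s => 'D_v f (z + s *: v)) 0 1 ltr01.
- by move=> x; rewrite in_itv /= => /andP[x0 x1]; apply: D; rewrite !ltW.
- apply: derivable_within_continuous => x; rewrite in_itv /= => xx.
  by have [] := D x xx.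
rewrite in_itv /= scale1r scale0r addr0 subr0 mulr1 => t01 E; exists t => //.
Qed.

Lemma ball_segment {V : normedModType R} {x y z : V} {d : R} (t : R) :
  `|y - x| < d -> `|z - x| < d -> 0 <= t <= 1 -> `|z + t *: (y - z) - x| < d.
Proof.
move=> yd zd /andP[t0 t1].
have -> : z + t *: (y - z) - x = t *: (y - x) + (1 - t) *: (z - x).
  have -> : y - z = (y - x) - (z - x) by rewrite opprB addrA subrK.
  by rewrite addrAC scalerBr scalerBl scale1r addrCA.
rewrite (le_lt_trans (ler_normD _ _))// !normrZ ger0_norm// ger0_norm ?subr_ge0//.
have -> : d = t * d + (1 - t) * d by ring.
have [t_gt0|t_le0] := ltP 0 t.
  by rewrite ltr_leD ?ltr_pM2l// ler_wpM2l ?subr_ge0// ltW.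
have -> : t = 0 by apply/eqP; rewrite eq_le t_le0.
by rewrite !mul0r !add0r subr0 !mul1r.
Qed.

(** On a small ball each partial derivative stays within 1 of its size at [x]; balls are convex, so
    the mean value theorem applies along segments. *)
Lemma locally_lipschitz {N} {a : R} {U : set 'rV[R]_N} {f} : open U -> Ck 1 a U f ->
  forall x, U x -> exists2 C : R, 0 <= C &
    \forall y \near x & z \near x, `|f y - f z| <= C * `|y - z|.
Proof.
move=> Uo fC x Ux.
exists (\sum_i (`|'D_(delta_mx 0 i) f x| + 1)).
  by apply: sumr_ge0 => i _; rewrite addr_ge0.
have [d d0 dU] := open_ballP Uo Ux.
have bnd (i : 'I_N) : \forall y \near x, `|'D_(delta_mx 0 i) f y| <= `|'D_(delta_mx 0 i) f x| + 1.
  have /cvgrPdist_le/(_ 1 ltr01) := Ck_cont (Ck_D (delta_mx 0 i) fC) Ux.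
  apply: filterS => y; rewrite -lerBlDl; apply: le_trans.
  by rewrite distrC; exact: lerB_dist.
have /near_ballP[d' d'0 dB]   : \forall y \near x, forall i : 'I_N, `|'D_(delta_mx 0 i)
  f y| <= `|'D_(delta_mx 0 i) f x| + 1.
  exact: (@filter_forall _ _ (fun i y => `|'D_(delta_mx 0 i) f y| <= `|'D_(delta_mx 0 i)
    f x| + 1) (nbhs x) _ bnd).
apply/near2_ballP; exists (Num.min d d'); first by rewrite lt_min d0.
move=> y z yd zd.
  have seg (t : R) : 0 <= t <= 1 -> `|z + t *: (y - z) - x| < Num.min d d'.
    exact: ball_segment.
have df (t : R) : 0 <= t <= 1 -> differentiable f (z + t *: (y - z)).
  by move=> /seg; rewrite lt_min => /andP[/dU Uw _]; exact: Ck_diff fC Uw.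
have [t t01] := MVT_line _ _ _ df.
have {}t01 : 0 <= t <= 1 by case/andP: t01 => *; rewrite !ltW.
rewrite subrKC => ->; rewrite derive_basis; last exact: df.
rewrite (le_trans (ler_norm_sum _ _ _))// mulr_suml; apply: ler_sum => i _.
rewrite normrM mulrC ler_pM// ?norm_coord_le//.
by apply: dB; have := seg _ t01; rewrite lt_min => /andP[].
Qed.

Context {a : R} (ha : 0 <= a <= 1).

Lemma lipschitz_holder {N} (f : 'rV[R]_N -> R) (x : 'rV[R]_N) C : 0 <= C ->
  (\forall y \near x & z \near x, `|f y - f z| <= C * `|y - z|) ->
  \forall y \near x & z \near x, `|f y - f z| <= C * `|y - z| `^ a.
Proof.
move=> C0 /near2_ballP[d d0 H]; apply/near2_ballP.
(* The radius 1/2 gives |y - z| <= 1, where t <= t^a because a <= 1. *)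
exists (Num.min d (2^-1)); first by rewrite lt_min d0/= invr_gt0.
move=> y z; rewrite !lt_min => /andP[yd y2] /andP[zd z2].
apply: le_trans (H y z yd zd) _; rewrite ler_wpM2l//.
have [->|yz] := eqVneq y z; first by rewrite subrr normr0 powR_ge0.
apply: ger1_powR; last by case/andP: ha.
rewrite normr_gt0 subr_eq0 yz/= (le_trans (ler_distD x _ _))// [`|x - z|]distrC.
by rewrite [leRHS]splitr mul1r lerD// ltW.
Qed.

(** All the content is at the lowest level: a C^1 function is locally Lipschitz, hence locally
    a-Hoelder since a <= 1. *)
Lemma Ck_pred {N k} {U : set 'rV[R]_N} {f} : open U -> Ck k.+1 a U f -> Ck k a U f.
Proof.
move=> Uo; elim: k f => [|k IH] f fC.
  split=> [x Ux|x Ux]; first exact: Ck_cont fC Ux.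
  have [C C0 /(lipschitz_holder _ _ _ C0)] := locally_lipschitz Uo fC x Ux; by exists C.
apply: Ck_succ => [x Ux|v]; first exact: Ck_diff fC Ux.
exact/IH/Ck_D.
Qed.

Lemma Ck_le {N k l} {U : set 'rV[R]_N} {f} : open U -> (l <= k)%N -> Ck k a U f -> Ck l a U f.
Proof.
move=> Uo /subnK <-; elim: (k - l)%N => // j IH H.
by apply: IH; apply: Ck_pred.
Qed.

Lemma Ck_cst {N k} {U : set 'rV[R]_N} (c : R) : Ck k a U (fun=> c).
Proof.
elim: k c => [|k IH] c.
  split=> x Ux; first exact: cst_continuous.
  exists 0; apply/near2_ballP; exists 1 => // y z _ _.
  by rewrite subrr normr0 mul0r.
apply: Ck_succ => [x Ux|v]; first exact: differentiable_cst.
rewrite (_ : 'D_v _ = fun=> 0); first exact: IH.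
by apply/funext => x; exact: derive_cst.
Qed.

Lemma Ck_coord {N k} {U : set 'rV[R]_N} (j : 'I_N) : Ck k a U (fun x => x 0 j).
Proof.
case: k => [|k].
  split=> x Ux; first exact: coord_continuous.
  exists 1; apply: lipschitz_holder => //.
  apply/near2_ballP; exists 1 => // y z _ _; rewrite mul1r.
  by apply: le_trans (norm_coord_le _ j); rewrite !mxE.
have df x : differentiable (fun x : 'rV[R]_N => x 0 j) x by exact: differentiable_coord.
apply: Ck_succ => // v.
rewrite (_ : 'D_v _ = fun=> v 0 j); first exact: Ck_cst.
apply/funext => x.
by rewrite -(derive_row (fun y : 'rV[R]_N => y))// derive_id.
Qed.

Lemma Ck_add {N k} {U : set 'rV[R]_N} f g : open U ->
  Ck k a U f -> Ck k a U g -> Ck k a U (fun x => f x + g x).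
Proof.
move=> Uo; elim: k f g => [|k IH] f g fC gC.
  split=> x Ux; first by apply: continuousD; [exact: (fC.1 x Ux)|exact: (gC.1 x Ux)].
  have [C hC] := fC.2 x Ux; have [C' hC'] := gC.2 x Ux.
  exists (C + C'); apply: filterS2 hC hC' => -[y z] /= h h'.
  rewrite mulrDl; apply: le_trans (lerD h h'); apply: le_trans (ler_normD _ _).
  by rewrite addrACA opprD.
apply: Ck_succ => [x Ux|v].
  by apply: differentiableD; [exact: Ck_diff fC Ux|exact: Ck_diff gC Ux].
apply: Ck_ext (IH _ _ (Ck_D v fC) (Ck_D v gC)) => // x Ux.
by rewrite deriveD//; apply/diff_derivable; [exact: Ck_diff fC Ux|exact: Ck_diff gC Ux].
Qed.

Lemma near_bounded {N} {f : 'rV[R]_N -> R} {x} : {for x, continuous f} ->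
  \forall y \near x, `|f y| <= `|f x| + 1.
Proof.
move=> /cvgrPdist_le/(_ 1 ltr01); apply: filterS => y; rewrite -lerBlDl; apply: le_trans.
by rewrite distrC; exact: lerB_dist.
Qed.

Lemma Ck_mul {N k} {U : set 'rV[R]_N} f g : open U ->
  Ck k a U f -> Ck k a U g -> Ck k a U (fun x => f x * g x).
Proof.
move=> Uo; elim: k f g => [|k IH] f g fC gC.
  split=> x Ux; first by apply: continuousM; [exact: (fC.1 x Ux)|exact: (gC.1 x Ux)].
  have [C /near2_ballP[d d0 hC]] := fC.2 x Ux; have [C' /near2_ballP[d' d'0 hC']] := gC.2 x Ux.
  have /near_ballP[e e0 he] := near_bounded (fC.1 x Ux).
  have /near_ballP[e' e'0 he'] := near_bounded (gC.1 x Ux).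
  exists ((`|f x| + 1) * C' + (`|g x| + 1) * C).
  apply/near2_ballP; exists (Num.min (Num.min d d') (Num.min e e'));
    first by rewrite !lt_min d0 d'0 e0.
  move=> y z; rewrite !lt_min =>
    /andP[/andP[yd yd'] /andP[ye ye']] /andP[/andP[zd zd'] /andP[ze ze']].
  have -> : f y * g y - f z * g z = f y * (g y - g z) + g z * (f y - f z) by ring.
  rewrite (le_trans (ler_normD _ _))// !normrM mulrDl -!mulrA lerD// ler_pM//;
    [exact: he|exact: hC'|exact: he'|exact: hC].
have df x (Ux : U x) := Ck_diff fC Ux.
have dg x (Ux : U x) := Ck_diff gC Ux.
apply: Ck_succ => [x Ux|v]; first by apply: differentiableM; [exact: df|exact: dg].
(* The Leibniz rule multiplies a derivative by an undifferentiated factor, which must first be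
   lowered to the class of the derivative. *)
have fC' := Ck_pred Uo fC; have gC' := Ck_pred Uo gC.
have := Ck_add _ _ Uo (IH _ _ fC' (Ck_D v gC)) (IH _ _ gC' (Ck_D v fC)).
apply: Ck_ext => // x Ux.
by rewrite deriveM//; apply/diff_derivable; [exact: df|exact: dg].
Qed.

Lemma Ck_sum {N k} {U : set 'rV[R]_N} (I : Type) (r : seq I) (P : pred I) (F : I -> 'rV[R]_N -> R) :
  open U -> (forall i, P i -> Ck k a U (F i)) -> Ck k a U (fun x => \sum_(i <- r | P i) F i x).
Proof.
move=> Uo FC; elim: r => [|i r IH].
  by apply: Ck_ext (Ck_cst 0) => // x _; rewrite big_nil.
have [Pi|Pi] := boolP (P i).
  by apply: Ck_ext (Ck_add _ _ Uo (FC i Pi) IH) => // x _; rewrite big_cons Pi.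
by apply: Ck_ext IH => // x _; rewrite big_cons (negbTE Pi).
Qed.

Lemma Ck_prod {N k} {U : set 'rV[R]_N} (I : Type) (r : seq I) (P : pred I) (F : I -> 'rV[R]_N ->
  R) :
  open U -> (forall i, P i -> Ck k a U (F i)) -> Ck k a U (fun x => \prod_(i <- r | P i) F i x).
Proof.
move=> Uo FC; elim: r => [|i r IH].
  by apply: Ck_ext (Ck_cst 1) => // x _; rewrite big_nil.
have [Pi|Pi] := boolP (P i).
  by apply: Ck_ext (Ck_mul _ _ Uo (FC i Pi) IH) => // x _; rewrite big_cons Pi.
by apply: Ck_ext IH => // x _; rewrite big_cons (negbTE Pi).
Qed.

Lemma Ck_det {N k n} {U : set 'rV[R]_N} (A : 'rV[R]_N -> 'M[R]_n) : open U ->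
  (forall i j, Ck k a U (fun x => A x i j)) -> Ck k a U (fun x => \det (A x)).
Proof.
move=> Uo AC; apply: Ck_sum => // s _; apply: Ck_mul => //; first exact: Ck_cst.
by apply: Ck_prod => // i _; exact: AC.
Qed.

Lemma Ck_adj {N k n} {U : set 'rV[R]_N} (A : 'rV[R]_N -> 'M[R]_n) i j : open U ->
  (forall i j, Ck k a U (fun x => A x i j)) -> Ck k a U (fun x => (\adj (A x)) i j).
Proof.
move=> Uo AC; apply: (Ck_ext (fun x => cofactor (A x) j i)) => // [x _|].
  by rewrite mxE.
apply: Ck_mul => //; first exact: Ck_cst.
apply: Ck_det => // i' j'; apply: Ck_ext (AC (lift j i') (lift i j')) => // x _.
by rewrite !mxE.
Qed.

Lemma Ck_inv {N k} {U : set 'rV[R]_N} f : open U -> (forall x, U x -> f x != 0) ->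
  Ck k a U f -> Ck k a U (fun x => (f x)^-1).
Proof.
move=> Uo f0; elim: k => [|k IH] fC.
  have cf x : U x -> {for x, continuous (fun x => (f x)^-1)}.
    by move=> Ux; apply: continuousV; [exact: f0|exact: (fC.1 x Ux)].
  split=> x Ux; first exact: cf.
  have [C /near2_ballP[d d0 hC]] := fC.2 x Ux.
  have [d' d'0 dU] := open_ballP Uo Ux.
  have /near_ballP[e e0 he] := near_bounded (cf x Ux).
  set B := `|_| + 1 in he.
  exists (B * B * C).
  apply/near2_ballP; exists (Num.min d (Num.min d' e)); first by rewrite !lt_min d0 d'0 e0.
  move=> y z; rewrite !lt_min => /and3P[yd /dU/f0 fy ye] /and3P[zd /dU/f0 fz ze].
  have -> : (f y)^-1 - (f z)^-1 = (f y)^-1 * (f z)^-1 * (f z - f y).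
    by field; rewrite fz fy.
  rewrite !normrM -mulrA -!mulrA ler_pM ?mulr_ge0// ?he// ler_pM// ?he// distrC; exact: hC.
have df x (Ux : U x) := Ck_diff fC Ux.
apply: Ck_succ => [x Ux|v]; first by apply: differentiableV; [exact: df|exact: f0].
have fC' := IH (Ck_pred Uo fC).
have := Ck_mul _ _ Uo (Ck_cst (-1)) (Ck_mul _ _ Uo (Ck_mul _ _ Uo fC' fC') (Ck_D v fC)).
apply: Ck_ext => // x Ux.
rewrite deriveV ?f0//; last exact/diff_derivable/df.
by rewrite /GRing.scale /= expr2 invfM; ring.
Qed.

Lemma Ck_sqrt {N k} {U : set 'rV[R]_N} f : open U -> (forall x, U x -> 0 < f x) ->
  Ck k a U f -> Ck k a U (fun x => Num.sqrt (f x)).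
Proof.
move=> Uo f0; elim: k => [|k IH] fC.
  have cf x : U x -> {for x, continuous (fun x => Num.sqrt (f x))}.
    by move=> Ux; apply: (continuous_comp (fC.1 x Ux)); exact: sqrt_continuous.
  have civ x : U x -> {for x, continuous (fun x => (Num.sqrt (f x))^-1)}.
    by move=> Ux; apply: continuousV (cf x Ux); rewrite gt_eqF// sqrtr_gt0 f0.
  split=> x Ux; first exact: cf.
  have [C /near2_ballP[d d0 hC]] := fC.2 x Ux.
  have [d' d'0 dU] := open_ballP Uo Ux.
  have /near_ballP[e e0 he] := near_bounded (civ x Ux).
  set B := `|_| + 1 in he.
  exists (B * C).
  apply/near2_ballP; exists (Num.min d (Num.min d' e)); first by rewrite !lt_min d0 d'0 e0.
  move=> y z; rewrite !lt_min => /and3P[yd /dU/f0 fy ye] /and3P[zd /dU/f0 fz ze].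
  have sy : 0 < Num.sqrt (f y) by rewrite sqrtr_gt0.
  have sz : 0 < Num.sqrt (f z) by rewrite sqrtr_gt0.
  have -> : Num.sqrt (f y) - Num.sqrt (f z) = (Num.sqrt (f y) + Num.sqrt (f z))^-1 * (f y - f z).
    rewrite -{3}(sqr_sqrtr (ltW fy)) -{3}(sqr_sqrtr (ltW fz)).
    by field; rewrite gt_eqF// addr_gt0.
  rewrite normrM -mulrA ler_pM//; last exact: hC.
  apply: le_trans (he y ye).
  by rewrite !ger0_norm ?invr_ge0 ?addr_ge0 ?sqrtr_ge0// lef_pV2 ?posrE// ?addr_gt0// lerDl ltW.
have df x (Ux : U x) := Ck_diff fC Ux.
have D x v : U x -> is_derive x v (fun x => Num.sqrt (f x)) ((2 * Num.sqrt (f x))^-1 * 'D_v f x) /\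
   differentiable (fun x => Num.sqrt (f x)) x.
  move=> Ux.
  have dS := is_derive1_sqrt (f0 x Ux).
  have dsq : differentiable (@Num.sqrt R) (f x) by apply/derivable1_diffP; case: dS.
  have dc : differentiable (Num.sqrt \o f) x by apply: differentiable_comp => //; exact: df.
  split => //; split; first exact: diff_derivable.
  rewrite deriveE// diff_comp//; last exact: df.
  rewrite /= -(deriveE v (df x Ux)).
  rewrite -['D_v f x in LHS]mulr1 [LHS]linearZ/= -deriveE//.
  by rewrite derive_val /GRing.scale/= mulrC.
apply: Ck_succ => [x Ux|v]; first exact: (D x 0 Ux).2.
have fC' := IH (Ck_pred Uo fC).
have h x : U x -> 2 * Num.sqrt (f x) != 0.
  by move=> Ux; rewrite mulf_neq0// gt_eqF// sqrtr_gt0 f0.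
have := Ck_mul _ _ Uo (Ck_inv _ Uo h (Ck_mul _ _ Uo (Ck_cst 2) fC')) (Ck_D v fC).
by apply: Ck_ext => // x Ux; have [[_ ->] _] := D x v Ux.
Qed.

(** Cramer's rule: the entries are cofactors divided by the determinant. *)
Lemma Ck_invmx {N k n} {U : set 'rV[R]_N} (A : 'rV[R]_N -> 'M[R]_n) i j : open U ->
  (forall x, U x -> A x \in unitmx) ->
  (forall i j, Ck k a U (fun x => A x i j)) -> Ck k a U (fun x => (invmx (A x)) i j).
Proof.
move=> Uo Au AC.
apply: (Ck_ext (fun x => (\det (A x))^-1 * (\adj (A x)) i j)) => // [x Ux|].
  by rewrite /invmx Au// [in RHS]mxE.
apply: Ck_mul => //; last exact: Ck_adj.
apply: Ck_inv => // [x Ux|]; last exact: Ck_det.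
by have := Au x Ux; rewrite unitmxE unitfE.
Qed.

Lemma derive_comp_row {N P} (f : 'rV[R]_P -> R) (g : 'rV[R]_N -> 'rV[R]_P) x v :
  differentiable g x -> differentiable f (g x) ->
  'D_v (f \o g) x = \sum_i 'D_v (fun x => g x 0 i) x * 'D_(delta_mx 0 i) f (g x).
Proof.
move=> dg df; rewrite deriveE; last exact: differentiable_comp.
rewrite diff_comp//= -deriveE// derive_basis//; apply: eq_bigr => i _.
by rewrite -deriveE// derive_row.
Qed.

Lemma lipschitz_continuous {V W : normedModType R} (g : V -> W) (x : V) (L : R) :
  0 <= L -> (\forall y \near x & z \near x, `|g y - g z| <= L * `|y - z|) ->
  {for x, continuous g}.
Proof.
move=> L0 /near2_ballP[d d0 hd]; apply/cvgrPdist_lt => e e0.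
have L1 : 0 < L + 1 by rewrite ltr_wpDl.
apply/near_ballP; exists (Num.min d (e / (L + 1))); first by rewrite lt_min d0 divr_gt0.
move=> y; rewrite lt_min => /andP[yd ye]; rewrite distrC.
apply: le_lt_trans (hd y x yd _) _; first by rewrite subrr normr0.
apply: (@le_lt_trans _ _ ((L + 1) * `|y - x|)).
  by rewrite ler_wpM2r// lerDl.
by rewrite mulrC -ltr_pdivlMr.
Qed.

(** The inner map has to be Lipschitz and not merely Hoelder: two Hoelder maps of exponent a would
    only compose to exponent a^2. *)
Lemma Ck0_comp {N P} {U : set 'rV[R]_N} {V : set 'rV[R]_P} (f : 'rV[R]_P -> R) (g : 'rV[R]_N ->
  'rV[R]_P) :
  (forall x, U x -> V (g x)) -> Ck 0 a V f ->
  (forall x, U x -> exists2 L : R, 0 <= L &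
    \forall y \near x & z \near x, `|g y - g z| <= L * `|y - z|) ->
  Ck 0 a U (fun x => f (g x)).
Proof.
move=> UV fC gL.
have cg x : U x -> {for x, continuous g}.
  by move=> /gL[L L0]; exact: lipschitz_continuous.
split=> x Ux; first by apply: continuous_comp; [exact: cg|exact: Ck_cont fC (UV x Ux)].
have [C /near2_ballP[d d0 hC]] := fC.2 (g x) (UV x Ux).
have [L L0 /near2_ballP[d' d'0 hL]] := gL x Ux.
have /near_ballP[e e0 ge] : \forall y \near x, `|g y - g x| < d.
  by have /cvgrPdist_lt/(_ d d0) := cg x Ux; apply: filterS => y; rewrite distrC.
(* Nothing says that [C] is nonnegative, hence the absolute value. *)
exists (`|C| * L `^ a).
apply/near2_ballP; exists (Num.min d' e); first by rewrite lt_min d'0.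
move=> y z; rewrite !lt_min => /andP[yd ye] /andP[zd ze].
apply: le_trans (hC _ _ (ge y ye) (ge z ze)) _.
rewrite -mulrA; apply: (@le_trans _ _ (`|C| * `|g y - g z| `^ a)).
  by rewrite ler_wpM2r ?powR_ge0 ?ler_norm.
rewrite ler_wpM2l// -powRM//; apply: ge0_ler_powR; rewrite ?nnegrE ?mulr_ge0//;
  first by case/andP: ha.
exact: hL.
Qed.

Lemma row_locally_lipschitz {N P} {U : set 'rV[R]_N} (g : 'rV[R]_N -> 'rV[R]_P) :
  open U -> (forall i, Ck 1 a U (fun x => g x 0 i)) ->
  forall x, U x -> exists2 L : R, 0 <= L &
    \forall y \near x & z \near x, `|g y - g z| <= L * `|y - z|.
Proof.
move=> Uo gC x Ux.
have hL i : exists L, \forall d \near 0^'+, forall y z, `|y - x| < d -> `|z - x| < d ->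
    `|g y 0 i - g z 0 i| <= L * `|y - z|.
  have [L L0 /near2_ballP[e e0 hL]] := locally_lipschitz Uo (gC i) x Ux.
  exists L; near=> r => y z yr zr.
  by apply: hL; [apply: lt_le_trans yr _|apply: lt_le_trans zr _]; near: r; exact: nbhs_right_le.
have {}hL i := cid (hL i).
pose L := \sum_i `|sval (hL i)|.
have L0 : 0 <= L by apply: sumr_ge0.
exists L => //; apply/near2_ballP; near (0 : R)^'+ => r; exists r => // y z yr zr.
apply: norm_row_le => [|i]; first by rewrite mulr_ge0.
rewrite !mxE; apply: (@le_trans _ _ (sval (hL i) * `|y - z|)).
  move: i y z yr zr; near: r; apply: filter_forall => i; exact: svalP (hL i).
by rewrite ler_wpM2r// (le_trans (ler_norm _))// /L (bigD1 i)//= lerDl sumr_ge0.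
Unshelve. all: by end_near. Qed.

(** The index [maxn k 1] keeps the inner map C^1, hence locally Lipschitz, also for [k] = 0. For
    larger [k] the chain rule and induction apply. *)
Lemma Ck_comp {N P k} {U : set 'rV[R]_N} {V : set 'rV[R]_P} (f : 'rV[R]_P -> R) (g : 'rV[R]_N ->
  'rV[R]_P) :
  open U -> open V -> (forall x, U x -> V (g x)) ->
  Ck k a V f -> (forall i, Ck (maxn k 1) a U (fun x => g x 0 i)) ->
  Ck k a U (fun x => f (g x)).
Proof.
move=> Uo Vo UV fC gC.
have dg x : U x -> differentiable g x.
  move=> Ux; apply/row_differentiableP => i.
  have gC1 := Ck_le Uo (leq_maxr k 1) (gC i); exact: Ck_diff gC1 Ux.
elim: k f fC gC => [|k IH] f fC gC.
  exact: Ck0_comp UV fC (row_locally_lipschitz _ Uo gC).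
have {}gC i : Ck k.+1 a U (fun x => g x 0 i) by have := gC i; rewrite (maxn_idPl _).
have df x (Ux : U x) := Ck_diff fC (UV x Ux).
apply: Ck_succ => [x Ux|v].
  by apply: differentiable_comp; [exact: dg|exact: df].
have : Ck k a U (fun x => \sum_i 'D_v (fun x => g x 0 i) x * 'D_(delta_mx 0 i) f (g x)).
  apply: Ck_sum => // i _; apply: Ck_mul => //; first exact: Ck_D.
  apply: (IH ('D_(delta_mx 0 i) f)); first exact: Ck_D.
  by move=> j; apply: Ck_le (gC j) => //; rewrite geq_max leqnSn.
apply: Ck_ext => // x Ux; rewrite -derive_comp_row//; [exact: dg|exact: df].
Qed.
End Algebra.

(** * The inverse function theorem *)

Section InverseFunction.
Context {R : realType}.

Lemma norm_mulmx_le {n p} (A : 'M[R]_(n, p)) : exists2 c : R, 0 < c & forall v : 'rV[R]_n,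
  `|v *m A| <= c * `|v|.
Proof.
pose c := 1 + \sum_i \sum_j `|A i j|.
have c0 : 0 < c by rewrite ltr_pwDl// sumr_ge0// => i _; exact: sumr_ge0.
exists c => // v; apply: norm_row_le => [|j]; first by rewrite mulr_ge0// ltW.
rewrite mxE (le_trans (ler_norm_sum _ _ _))//.
apply: (@le_trans _ _ (\sum_i `|A i j| * `|v|)).
  by apply: ler_sum => i _; rewrite normrM mulrC ler_wpM2l// norm_coord_le.
rewrite -mulr_suml ler_wpM2r// /c ler_wpDl// ler_sum// => i _.
by rewrite (bigD1 j)//= lerDl sumr_ge0.
Qed.

Lemma mulmx_inj_unit {n} (A : 'M[R]_n) : (forall v : 'rV[R]_n, v *m A = 0 -> v = 0) -> A \in unitmx.
Proof.
move=> H; rewrite -row_free_unit -kermx_eq0; apply/eqP/row_matrixP => i.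
by rewrite row0; apply: H; rewrite -row_mul mulmx_ker row0.
Qed.

Lemma dist_continuous {V : normedModType R} (x : V) : continuous (fun y => `|y - x|).
Proof.
move=> y; apply: cvg_norm; apply: cvgB; [exact: cvg_id|exact: cvg_cst].
Qed.

Lemma closed_ball_compact {n} (x : 'rV[R]_n) (r : R) : compact [set y | `|y - x| <= r].
Proof.
apply: bounded_closed_compact.
  exists (`|x| + r); split; first exact: num_real.
  move=> M xM y /= yr; apply: le_trans (ltW xM).
  by rewrite -[y](subrK x) addrC (le_trans (ler_normD _ _))// lerD2l.
have -> : [set y | `|y - x| <= r] = (fun y => `|y - x|) @^-1` [set t | t <= r] by [].
apply: closed_comp; last exact: closed_le.
by move=> y _; apply: dist_continuous.
Qed.

(* A minimiser c of |g - y| on the ball solves g c = y: otherwise the step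
   c + (y - g c) at least halves the distance to y. *)
Lemma perturbation_onto {n} (g : 'rV[R]_n -> 'rV[R]_n) (u1 : 'rV[R]_n) (r : R) : 0 < r ->
  (forall u, `|u - u1| <= r -> {for u, continuous g}) ->
  (forall u u', `|u - u1| <= r -> `|u' - u1| <= r ->
    `|(g u - g u') - (u - u')| <= 2^-1 * `|u - u'|) ->
  forall y, `|y - g u1| < r / 8 -> exists2 u, `|u - u1| <= r & g u = y.
Proof.
move=> r0 gc H y yd; set K := [set u | `|u - u1| <= r].
have u1K : K u1 by rewrite /K /= subrr normr0 ltW.
have gL u u' : K u -> K u' -> `|g u - g u'| <= 2 * `|u - u'|.
  move=> Ku Ku'; have := H u u' Ku Ku'.
  have := ler_normD (g u - g u' - (u - u')) (u - u'); rewrite subrK.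
  by have := normr_ge0 (u - u'); lra.
have gI u u' : K u -> K u' -> `|u - u'| <= 2 * `|g u - g u'|.
  move=> Ku Ku'; have := H u u' Ku Ku'.
  have := ler_normD (u - u' - (g u - g u')) (g u - g u'); rewrite subrK [`|u - u' - _|]distrC.
  by have := normr_ge0 (u - u'); lra.
have cf : {within K, continuous (fun u => `|g u - y|)}.
  apply: continuous_in_subspaceT => u; rewrite inE => Ku.
  by apply: (@continuous_comp _ _ _ g (fun w => `|w - y|)); [exact: gc|exact: dist_continuous].
have [c] := @EVT_min_rV R n (fun u => `|g u - y|) K (ex_intro _ u1 u1K) (closed_ball_compact _ _)
  cf.
rewrite inE => Kc cmin; exists c => //.
have cd : `|g c - y| <= `|y - g u1| by rewrite [leRHS]distrC; apply: cmin; rewrite inE.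
(* As |y - g u1| < r/8, the minimiser lies within r/2 of [u1], which leaves room for a step [d]
   shorter than r/8. *)
have cu1 : `|c - u1| <= 4 * `|y - g u1|.
  have := gI c u1 Kc u1K; have := ler_distD y (g c) (g u1); lra.
pose d := y - g c.
have Kd : K (c + d).
  rewrite /K /= addrAC; have := ler_normD (c - u1) d; rewrite /d [`|y - g c|]distrC; lra.
have := H (c + d) c Kd Kc; rewrite [c + d]addrC addrK.
have := cmin (d + c); rewrite inE addrC => /(_ Kd).
have -> : g (c + d) - g c - d = g (c + d) - y by rewrite /d opprB addrA subrK.
rewrite /d [`|y - g c|]distrC => h1 h2.
apply/eqP; rewrite -subr_eq0 -normr_eq0; apply/eqP; have := normr_ge0 (g c - y); lra.
Qed.

(** The transpose of the usual Jacobian matrix: vectors are rows, so the derivative acts by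
    multiplication on the right. *)
Definition jac {n p} (G : 'rV[R]_n -> 'rV[R]_p) u : 'M[R]_(n, p) :=
  \matrix_(i, j) 'D_(delta_mx 0 i) (fun u => G u 0 j) u.

Lemma derive_jac {n p} (G : 'rV[R]_n -> 'rV[R]_p) u v : differentiable G u ->
  'D_v G u = v *m jac G u.
Proof.
move=> dG; apply/rowP => j; rewrite derive_row// mxE derive_basis; last first.
  exact: (row_differentiableP G u).1 dG j.
by apply: eq_bigr => i _; rewrite mxE.
Qed.

Lemma ball_lipschitz {n} (f : 'rV[R]_n -> R) (x : 'rV[R]_n) (d e : R) : 
  (forall w, `|w - x| < d -> differentiable f w) ->
  (forall w i, `|w - x| < d -> `|'D_(delta_mx 0 i) f w| <= e) ->
  forall y z, `|y - x| < d -> `|z - x| < d -> `|f y - f z| <= n%:R * e * `|y - z|.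
Proof.
move=> df De y z yd zd.
have [|t /andP[t0 t1]] := MVT_line f z (y - z).
  by move=> t t01; apply: df; exact: ball_segment.
have wd : `|z + t *: (y - z) - x| < d by apply: ball_segment => //; rewrite !ltW.
rewrite subrKC => ->; rewrite derive_basis; last exact: df.
rewrite (le_trans (ler_norm_sum _ _ _))//.
apply: (@le_trans _ _ (\sum_(i < n) e * `|y - z|)).
  apply: ler_sum => i _.
  by rewrite normrM mulrC ler_pM// ?norm_coord_le// De.
by rewrite sumr_const card_ord -[leLHS]mulr_natl mulrA.
Qed.

Context {a : R} (ha : 0 <= a <= 1).

(** Multiplication by the inverse of [jac G u0] makes the derivative at [u0] the identity. What is
    left after subtracting the identity has small partial derivatives near [u0], hence is a
    contraction there. *)
Lemma near_identity {n} {U : set 'rV[R]_n} (G : 'rV[R]_n -> 'rV[R]_n) u0 :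
  open U -> U u0 -> (forall j, Ck 1 a U (fun u => G u 0 j)) ->
  jac G u0 \in unitmx ->
  exists2 r : R, 0 < r & [/\ forall u, `|u - u0| < r -> U u,
    forall u, `|u - u0| < r -> jac G u \in unitmx &
    forall u u', `|u - u0| < r -> `|u' - u0| < r ->
      `|(G u *m invmx (jac G u0) - G u' *m invmx (jac G u0)) - (u - u')| <= 2^-1 * `|u - u'|].
Proof.
move=> Uo Uu0 GC Ju.
have [d d0 dU] := open_ballP Uo Uu0.
have dG u : U u -> differentiable G u.
  by move=> Uu; apply/row_differentiableP => j; exact: Ck_diff (GC j) Uu.
have JC i j : Ck 0 a U (fun u => jac G u i j).
  by apply: Ck_ext (Ck_D (delta_mx 0 i) (GC j)) => // x _; rewrite mxE.
have /near_ballP[d' d'0 detJ] : \forall u \near u0, \det (jac G u) != 0.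
  have cd := Ck_cont (Ck_det ha _ Uo JC) Uu0.
  move: Ju; rewrite unitmxE unitfE => J0.
  exact: (cvgr_neq0 _ cd J0).
set A := invmx (jac G u0).
pose h j u := (G u *m A) 0 j - u 0 j.
have hC j : Ck 1 a U (h j).
  apply: (Ck_ext (fun u => \sum_k G u 0 k * A k j + -1 * u 0 j)) => // [x _|].
    by rewrite /h mxE mulN1r.
  apply: Ck_add => //.
    by apply: Ck_sum => // k _; apply: Ck_mul => //; exact: Ck_cst.
  by apply: Ck_mul => //; [exact: Ck_cst|exact: Ck_coord].
have h0 (i j : 'I_n) : 'D_(delta_mx 0 i) (h j) u0 = 0.
  have -> : h j = (\sum_k A k j *: (fun u => G u 0 k)) - (fun u => u 0 j).
    apply/funext => x; rewrite /h mxE !fctE fct_sumE; congr (_ - _).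
    by apply: eq_bigr => k _; rewrite mulrC.
  have dGk k v : derivable (fun u => G u 0 k) u0 v by apply/diff_derivable; exact: Ck_diff (GC k)
    Uu0.
  have dc v : derivable (fun u : 'rV[R]_n => u 0 j) u0 v by apply/diff_derivable;
    exact: differentiable_coord.
  rewrite deriveB//; last by apply: derivable_sum => k; exact: derivableZ.
  rewrite derive_sum; last by move=> k; exact: derivableZ.
  rewrite -(derive_row (fun y : 'rV[R]_n => y))// derive_id.
  have := mulmxV Ju => /matrixP/(_ i j); rewrite !mxE eqxx/= eq_sym => <-.
  apply/eqP; rewrite subr_eq0; apply/eqP; apply: eq_bigr => k _.
  by rewrite deriveZ// mxE mulrC.
(* [ball_lipschitz] costs a factor [n], so this bound yields the Lipschitz constant 1/2; [n.+1]
   keeps the denominator nonzero when [n] = 0. *)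
pose e : R := (2 * n.+1%:R)^-1.
have e0 : 0 < e by rewrite invr_gt0 mulr_gt0.
have /near_ballP[d'' d''0 hd] : \forall w \near u0, forall ij : 'I_n * 'I_n,
  `|'D_(delta_mx 0 ij.1) (h ij.2) w| <= e.
  apply: (@filter_forall _ _ (fun (ij : 'I_n * 'I_n) w => `|'D_(delta_mx 0 ij.1) (h ij.2)
    w| <= e) (nbhs u0)) => -[i j] /=.
  have /cvgrPdist_le/(_ e e0) := Ck_cont (Ck_D (delta_mx 0 i) (hC j)) Uu0.
  by apply: filterS => w; rewrite h0 sub0r normrN.
exists (Num.min d (Num.min d' d'')); first by rewrite !lt_min d0 d'0.
split=> [u|u|u u' ud u'd].
- by rewrite !lt_min => /and3P[/dU].
- by rewrite !lt_min unitmxE unitfE => /and3P[_ /detJ].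
apply: norm_row_le => [|j]; first by rewrite mulr_ge0.
have -> : (G u *m A - G u' *m A - (u - u')) 0 j = h j u - h j u'.
  by rewrite /h !mxE; ring.
apply: le_trans (_ : n%:R * e * `|u - u'| <= _); last first.
  rewrite ler_wpM2r// /e invfM mulrCA ler_piMr// ler_pdivrMr//.
  by rewrite mul1r ler_nat.
apply: (ball_lipschitz (h j) u0 _ _ _ _ u u' ud u'd) => [w|w i].
  by rewrite !lt_min => /and3P[/dU Uw _ _]; exact: Ck_diff (hC j) Uw.
by rewrite !lt_min => /and3P[_ _ /hd/(_ (i, j))].
Qed.

End InverseFunction.

(** * The local inverse and its class *)

Section LocalInverse.
Context {R : realType} {a : R} (ha : 0 <= a <= 1).

Lemma open_ball_norm {V : normedModType R} (x : V) (r : R) : open [set y | `|y - x| < r].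
Proof.
have -> : [set y | `|y - x| < r] = (fun y => `|y - x|) @^-1` [set t | t < r] by [].
by apply: open_comp; [move=> y _; apply: dist_continuous|exact: open_lt].
Qed.

Lemma open_ballI {V : normedModType R} (U : set V) :
  (forall x, U x -> exists2 d : R, 0 < d & forall y, `|y - x| < d -> U y) -> open U.
Proof.
by move=> H; rewrite openE => x /H xU; exact: ((near_ballP x U).2 xU).
Qed.

(** The derivative of [H] at w is the inverse of the Jacobian at [H w]. A Lipschitz [H] therefore
    has derivatives of class C^(0,a), and every class gained for [H] is passed on to its derivatives
    by this formula, until the class of [G] is reached. *)
Theorem local_inverse {n k} {U : set 'rV[R]_n} (G : 'rV[R]_n -> 'rV[R]_n) u0 :
  open U -> U u0 -> (forall j, Ck k.+1 a U (fun u => G u 0 j)) ->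
  jac G u0 \in unitmx ->
  exists (B : set 'rV[R]_n) (H : 'rV[R]_n -> 'rV[R]_n),
    [/\ open B, B u0, B `<=` U &
     [/\ open (G @` B), forall u, B u -> H (G u) = u &
         forall j, Ck k.+1 a (G @` B) (fun w => H w 0 j)]].
Proof.
move=> Uo Uu0 GC Ju0.
have GC1 j : Ck 1 a U (fun u => G u 0 j) by apply: Ck_le (GC j).
have [r r0 [rU rJ rI]] := near_identity ha G u0 Uo Uu0 GC1 Ju0.
set A := invmx (jac G u0) in rI.
have [cA cA0 hA] := norm_mulmx_le A.
pose B := [set u | `|u - u0| < r].
have Bo : open B by exact: open_ball_norm.
have Bu0 : B u0 by rewrite /B /= subrr normr0.
have dG u : U u -> differentiable G u.
  by move=> Uu; apply/row_differentiableP => j; exact: Ck_diff (GC j) Uu.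
(* [G] cannot shrink distances by more than a fixed factor. This gives injectivity, the Lipschitz
   bound for [H], and the error control when [H] is differentiated. *)
have gA u u' : B u -> B u' -> `|u - u'| <= 2 * cA * `|G u - G u'|.
  move=> Bu Bu'; have := rI u u' Bu Bu'; have := hA (G u - G u'); rewrite mulmxBl.
  set g := _ *m A - _ *m A.
  have := ler_normD (u - u' - g) g; rewrite subrK [`|u - u' - g|]distrC; lra.
have Ginj u u' : B u -> B u' -> G u = G u' -> u = u'.
  move=> Bu Bu' E; apply/eqP; rewrite -subr_eq0 -normr_le0.
  by have := gA u u' Bu Bu'; rewrite E subrr normr0 mulr0.
pose H w := xget u0 [set u | B u /\ G u = w].
have HG u : B u -> H (G u) = u.
  move=> Bu; have [Bh Gh] : [set v | B v /\ G v = G u] (H (G u)) by apply: (@xgetI _ u0 _ u).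
  exact: Ginj.
have Go : open (G @` B).
  apply: open_ballI => _ [u1 Bu1 <-].
  have [s s0 sB] := open_ballP Bo Bu1.
  have su u : `|u - u1| <= s / 2 -> B u.
    by move=> us; apply: sB; apply: le_lt_trans us _; rewrite ltr_pdivrMr// ltr_pMr// ltr1n.
  have s20 : 0 < s / 2 by rewrite divr_gt0.
  have gc u : `|u - u1| <= s / 2 -> {for u, continuous (fun u => G u *m A)}.
    move=> /su Bu; apply: (@continuous_comp _ _ _ G (mulmxr A)).
      by apply: differentiable_continuous; apply: dG; exact: rU.
    apply: (lipschitz_continuous _ _ cA); first exact: ltW.
    by apply/near2_ballP; exists 1 => // y z _ _; rewrite /= -mulmxBl.
  have P := perturbation_onto (fun u => G u *m A) u1 (s / 2) s20 gc (fun u u' us us' =>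
    rI u u' (su u us) (su u' us')).
  (* The radius r/8 of [perturbation_onto] with r = s/2; dividing by [cA] accounts for the
     multiplication by [A]. *)
  exists (s / 2 / 8 / cA); first by rewrite !divr_gt0.
  move=> y yd.
  have [|u us E] := P (y *m A).
    rewrite -mulmxBl; apply: le_lt_trans (hA _) _.
    by rewrite mulrC -ltr_pdivlMr.
  exists u; first exact: su.
  have Au : A \in unitmx by rewrite unitmx_inv.
  exact: (can_inj (mulmxK Au)).
have HL w : (G @` B) w -> exists2 L : R, 0 <= L & \forall y \near w & z \near w,
  `|H y - H z| <= L * `|y - z|.
  move=> Ww; exists (2 * cA); first by rewrite mulr_ge0// ltW.
  have [d d0 dW] := open_ballP Go Ww.
  apply/near2_ballP; exists d => // y z /dW[u Bu <-] /dW[u' Bu' <-].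
  by rewrite !HG//; exact: gA.
have HB w : (G @` B) w -> B (H w) by move=> [u Bu <-]; rewrite HG.
have GH w : (G @` B) w -> G (H w) = w by move=> [u Bu <-]; rewrite HG.
have dH w : (G @` B) w -> differentiable H w /\ 'd H w = mulmxr (invmx (jac G (H w))) :> (_ -> _).
  move=> Ww; have Bu1 := HB _ Ww; set u1 := H w in Bu1 *.
  have J1 := rJ u1 Bu1.
  have [c c0 hc] := norm_mulmx_le (invmx (jac G u1)).
  apply: differentiable_intro.
    move=> v; apply: (lipschitz_continuous _ _ c); first exact: ltW.
    by apply/near2_ballP; exists 1 => // y z _ _; rewrite /= -mulmxBl.
  move=> e e0.
  (* [c] bounds the inverse Jacobian and [2 * cA] the growth of [H]; both cancel in the final
     estimate. *)
  have [_ /eqaddoP/(_ (e / (c * (2 * cA))))] := (diff_locallyP _ _).1 (dG u1 (rU _ Bu1)).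
  have e'0 : 0 < e / (c * (2 * cA)) by rewrite divr_gt0// mulr_gt0// mulr_gt0.
  move=> /(_ e'0) /near_ballP[d d0 hd].
  have [d' d'0 dW] := open_ballP Go Ww.
  apply/near_ballP; exists (Num.min d' (d / (2 * cA)));
    first by rewrite lt_min d'0 divr_gt0// mulr_gt0.
  move=> h; rewrite subr0 lt_min => /andP[hd' hhd].
  have Wh : (G @` B) (h + w) by apply: dW; rewrite addrK.
  have Bu := HB _ Wh; set u := H (h + w) in Bu *.
  have Eh : h = G u - G u1 by rewrite !GH// addrK.
  have ku : `|u - u1| <= 2 * cA * `|h| by rewrite Eh; exact: gA.
  have := hd (u - u1); rewrite subr0 => /(_ _)/=.
  have -> : `|u - u1| < d by apply: le_lt_trans ku _; rewrite mulrC -ltr_pdivlMr// mulr_gt0.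
  move=> /(_ isT).
  have dGu1 : differentiable G u1 by apply: dG; exact: rU.
  have -> : (G \o shift u1 - (cst (G u1) + 'd G u1)) (u - u1) = h - (u - u1) *m jac G u1.
    by rewrite -derive_jac// deriveE// Eh !fctE /= subrK opprD addrA.
  move=> hh.
  have -> : u - u1 - h *m invmx (jac G u1) = - ((h - (u - u1) *m jac G u1) *m invmx (jac G u1)).
    by rewrite mulmxBl mulmxK// opprB.
  rewrite normrN; apply: le_trans (hc _) _.
  apply: (@le_trans _ _ (c * (e / (c * (2 * cA)) * `|u - u1|))); first by rewrite ler_wpM2l// ltW.
  apply: (@le_trans _ _ (c * (e / (c * (2 * cA)) * (2 * cA * `|h|)))).
    by rewrite !ler_wpM2l// ltW.
  rewrite le_eqVlt; apply/orP; left; apply/eqP; field.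
  by rewrite !gt_eqF.
have DH w v j : (G @` B) w -> 'D_v (fun w => H w 0 j) w = \sum_i v 0 i * invmx (jac G (H w)) i j.
  move=> Ww; have [dHw dHE] := dH w Ww.
  by rewrite -derive_row// deriveE// dHE /= mxE.
have JC l i j : (l <= k)%N -> Ck l a B (fun u => invmx (jac G u) i j).
  move=> lk; apply: (Ck_invmx ha (jac G) i j Bo rJ).
  move=> i' j'; apply: Ck_ext (_ : Ck l a B ('D_(delta_mx 0 i') (fun u => G u 0 j'))) => // [x _|].
    by rewrite mxE.
  by apply: Ck_sub rU _; apply: Ck_le lk _ => //; apply: Ck_D; exact: GC.
(* Start of the bootstrap: only the Lipschitz bound on [H] is available, so the composition is
   estimated at level 0. *)
have HC1 j : Ck 1 a (G @` B) (fun w => H w 0 j).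
  apply: Ck_succ => [w Ww|v]; first exact: (row_differentiableP H w).1 (dH w Ww).1 j.
  apply: (Ck_ext (fun w => \sum_i v 0 i * invmx (jac G (H w)) i j)) => // [w Ww|];
    first by rewrite DH.
  apply: Ck_sum => // i _; apply: Ck_mul => //; first exact: Ck_cst.
  by apply: (Ck0_comp ha (fun u => invmx (jac G u) i j) H HB) => //; exact: JC.
exists B, H; split => //; split => // j.
have : forall l, (l <= k)%N -> forall j, Ck l.+1 a (G @` B) (fun w => H w 0 j).
  elim=> [//|l IH] lk i.
  apply: Ck_succ => [w Ww|v]; first exact: (row_differentiableP H w).1 (dH w Ww).1 i.
  apply: (Ck_ext (fun w => \sum_i' v 0 i' * invmx (jac G (H w)) i' i)) => // [w Ww|];
    first by rewrite DH.
  apply: Ck_sum => // i' _; apply: Ck_mul => //; first exact: Ck_cst.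
  apply: (Ck_comp ha (fun u => invmx (jac G u) i' i) H Go Bo HB); first exact: JC.
  by move=> j'; apply: Ck_le (IH (ltnW lk) j') => //; rewrite geq_max leqnn.
by move=> /(_ k (leqnn k) j).
Qed.

End LocalInverse.

(** * The cone over the sphere *)

Section Dot.
Context {R : realType} {N : nat}.
Implicit Types x y z : 'rV[R]_N.

Lemma dotC x y : dot x y = dot y x.
Proof. by apply: eq_bigr => i _; rewrite mulrC. Qed.

Lemma dotDl x y z : dot (x + y) z = dot x z + dot y z.
Proof. by rewrite -big_split; apply: eq_bigr => i _; rewrite mxE mulrDl. Qed.

Lemma dotZl c x y : dot (c *: x) y = c * dot x y.
Proof. by rewrite /dot mulr_sumr; apply: eq_bigr => i _; rewrite mxE mulrA. Qed.

Lemma dotNl x y : dot (- x) y = - dot x y.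
Proof. by rewrite -scaleN1r dotZl mulN1r. Qed.

Lemma dotBl x y z : dot (x - y) z = dot x z - dot y z.
Proof. by rewrite dotDl dotNl. Qed.

Lemma dotDr x y z : dot z (x + y) = dot z x + dot z y.
Proof. by rewrite dotC dotDl !(dotC z). Qed.

Lemma dotZr c x y : dot x (c *: y) = c * dot x y.
Proof. by rewrite dotC dotZl dotC. Qed.

Lemma dotNr x y : dot x (- y) = - dot x y.
Proof. by rewrite dotC dotNl dotC. Qed.

Lemma dot_sumr (I : Type) (r : seq I) (P : pred I) (F : I -> 'rV[R]_N) y :
  dot y (\sum_(i <- r | P i) F i) = \sum_(i <- r | P i) dot y (F i).
Proof.
elim/big_ind2: _ => [|_ s1 _ s2 <- <-|//]; last by rewrite dotDr.
by rewrite /dot big1// => i _; rewrite mxE mulr0.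
Qed.

Lemma dot0l y : dot 0 y = 0.
Proof. by rewrite /dot big1// => i _; rewrite mxE mul0r. Qed.

Lemma dot0r y : dot y 0 = 0.
Proof. by rewrite dotC dot0l. Qed.

Lemma dot_ge0 x : 0 <= dot x x.
Proof. by apply: sumr_ge0 => i _; rewrite -expr2 sqr_ge0. Qed.

Lemma dot_eq0 x : (dot x x == 0) = (x == 0).
Proof.
apply/idP/idP => [|/eqP->]; last by rewrite dot0l.
rewrite psumr_eq0 => [|i _]; last by rewrite -expr2 sqr_ge0.
move=> /allP H; apply/eqP/rowP => i; rewrite mxE; apply/eqP.
by have := H i (mem_index_enum i); rewrite mulf_eq0 orbb.
Qed.

Lemma dot_gt0 x : (0 < dot x x) = (x != 0).
Proof. by rewrite lt_neqAle dot_ge0 andbT eq_sym dot_eq0. Qed.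

Lemma sphere_neq0 x : dot x x = 1 -> x != 0.
Proof. by move=> x1; rewrite -dot_gt0 x1. Qed.

Lemma dot_continuous {T : topologicalType} (f g : T -> 'rV[R]_N) t :
  {for t, continuous f} -> {for t, continuous g} ->
  {for t, continuous (fun s => dot (f s) (g s))}.
Proof.
move=> cf cg; apply: cvg_big => [|i _]; first exact: add_continuous.
by apply: cvgM; [exact: (row_continuousP f t).1|exact: (row_continuousP g t).1].
Qed.

Lemma dotl_continuous v : continuous (fun x : 'rV[R]_N => dot x v).
Proof. move=> x; apply: (@dot_continuous _ (fun y : 'rV[R]_N => y) (fun=> v));
  last exact: cst_continuous.
by []. Qed.

(* [normalize 0 = 0] is not on the sphere. *)
Definition normalize x := (Num.sqrt (dot x x))^-1 *: x.

Lemma sqrt_dot_gt0 x : x != 0 -> 0 < (Num.sqrt (dot x x))^-1.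
Proof. by move=> x0; rewrite invr_gt0 sqrtr_gt0 dot_gt0. Qed.

Lemma normalizeE x : x != 0 -> exists2 c : R, 0 < c & normalize x = c *: x.
Proof. by move=> x0; exists (Num.sqrt (dot x x))^-1 => //; exact: sqrt_dot_gt0. Qed.

Lemma normalize0 : normalize 0 = 0.
Proof. by rewrite /normalize scaler0. Qed.

Lemma dot_normalize x : x != 0 -> dot (normalize x) (normalize x) = 1.
Proof.
move=> x0; rewrite dotZl dotZr mulrA -invfM -expr2 sqr_sqrtr ?dot_ge0//.
by rewrite mulVf// dot_eq0.
Qed.

Lemma normalize_id x : dot x x = 1 -> normalize x = x.
Proof. by move=> x1; rewrite /normalize x1 sqrtr1 invr1 scale1r. Qed.

Lemma normalizeZ c x : 0 < c -> normalize (c *: x) = normalize x.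
Proof.
move=> c0; rewrite /normalize dotZl dotZr mulrA sqrtrM ?mulr_ge0 ?ltW//.
rewrite -expr2 sqrtr_sqr gtr0_norm// scalerA invfM mulrAC mulVf ?mul1r//.
by rewrite gt_eqF.
Qed.

Lemma normalize_eq x y : x != 0 -> y != 0 -> normalize x = normalize y -> exists2 k : R, 0 < k &
  y = k *: x.
Proof.
move=> /normalizeE[c c0 ->] /normalizeE[d d0 ->] E.
exists (d^-1 * c); first by rewrite mulr_gt0// invr_gt0.
by rewrite -scalerA E scalerA mulVf ?scale1r// gt_eqF.
Qed.

Lemma normalize_comp_continuous {T : topologicalType} (f : T -> 'rV[R]_N) t :
  f t != 0 -> {for t, continuous f} -> {for t, continuous (fun s => normalize (f s))}.
Proof.
move=> x0 cf; apply: cvgZ; last exact: cf.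
apply: cvgV; first by rewrite gt_eqF// sqrtr_gt0 dot_gt0.
have cd : {for t, continuous (fun s => dot (f s) (f s))} by apply: dot_continuous.
exact: (continuous_comp cd (@sqrt_continuous R _)).
Qed.

Lemma normalize_continuous x : x != 0 -> {for x, continuous normalize}.
Proof. by move=> x0; apply: (@normalize_comp_continuous _ (fun y : 'rV[R]_N => y)). Qed.

End Dot.

Lemma near_neq0 {R : realType} {V : normedModType R} (x : V) : x != 0 -> \forall y \near x, y != 0.
Proof.
move=> x0; apply/near_ballP; exists `|x|; first by rewrite normr_gt0.
by move=> y; apply: contraTneq => ->; rewrite sub0r normrN ltxx.
Qed.

(** * Induction along a connected set *)

Section ConnectedInduction.
Context {R : realType} {V : normedModType R}.

(** The points of [M] satisfying [P] form a nonempty, relatively open and relatively closed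
    subset. *)
Lemma connected_ind (M P : set V) : connected M -> (exists2 x, M x & P x) ->
  (forall x, M x -> P x -> exists2 d : R, 0 < d & forall y, M y -> `|y - x| < d -> P y) ->
  (forall x, M x -> (forall d : R, 0 < d -> exists y, [/\ M y, `|y - x| < d & P y]) -> P x) ->
  forall x, M x -> P x.
Proof.
move=> Mc [x0 Mx0 Px0] Po Pc.
(* A union of balls whose trace on [M] lies in Q: an ambient open set that realises a relatively
   open one. *)
pose O (Q : set V) := [set y | exists x, [/\ M x, Q x & exists2 d : R, `|y - x| < d & forall y,
  M y -> `|y - x| < d -> Q y]].
have Oo Q : open (O Q).
  apply: open_ballI => y [x [Mx Qx [d yd H]]].
  exists (d - `|y - x|); first by rewrite subr_gt0.
  move=> z zy; exists x; split => //; exists d => //.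
  rewrite ltrBrDr in zy; apply: le_lt_trans zy; exact: ler_distD.
have E : [set x | M x /\ P x] = M.
  apply: Mc; first by exists x0.
    exists (O P); first exact: Oo.
    apply/seteqP; split => [x [Mx Px]|y [My [x [Mx Px [d yd H]]]]]; last by split=> //; exact: H.
    split => //; exists x; split => //; have [d d0 H] := Po x Mx Px.
    by exists d => //; rewrite subrr normr0.
  exists (~` (O (~` P))); first by rewrite closedC; exact: Oo.
  apply/seteqP; split => [x [Mx Px]|y [My H]].
    by split=> // -[y [My Py [d xd H]]]; exact: H Px.
  split=> //; apply: contrapT => Py; apply: H; exists y; split => //.
  apply: contrapT => H; apply: Py; apply: Pc => // d d0.
  apply: contrapT => H'; apply: H; exists d; first by rewrite subrr normr0.
  by move=> z Mz zd Pz; apply: H'; exists z.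
by move=> x Mx; have : M x by []; rewrite -{1}E => -[].
Qed.
End ConnectedInduction.

Lemma convex_lt0 {R : realType} (t u v : R) : 0 <= t <= 1 -> u < 0 -> v < 0 -> (1 - t)
  * u + t * v < 0.
Proof.
move=> /andP[t0 t1] u0 v0; have [->|tn0] := eqVneq t 0; first by rewrite subr0 mul1r mul0r addr0.
rewrite ltr_wnDl//; first by rewrite mulr_ge0_le0 ?subr_ge0// ltW.
by rewrite pmulr_rlt0// lt_neqAle eq_sym tn0.
Qed.

(** * Injectivity of the Gauss map *)

Section Global.
Context {R : realType} {N : nat}.
Local Notation E := 'rV[R]_N.
Variables (M Om : set E) (nu : E -> E).
Hypothesis MS : forall x, M x -> dot x x = 1.
Hypothesis Mcl : closed M.
Hypothesis OmC : exists2 y, (@unit_sphere R N `\` M) y &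
  Om = connected_component (@unit_sphere R N `\` M) y.
Hypothesis nu1 : forall x, M x -> dot (nu x) (nu x) = 1.
Hypothesis nu0 : forall x, M x -> dot (nu x) x = 0.
Hypothesis inner : forall x, M x ->
  \forall t \near (0 : R)^'+, Om (cos t *: x - sin t *: nu x).
Hypothesis outer : forall x, M x ->
  \forall t \near (0 : R)^'+, ~ Om (cos t *: x + sin t *: nu x).

Lemma Om_sphere z : Om z -> dot z z = 1.
Proof. by have [y _ ->] := OmC; move=> /connected_component_sub[]. Qed.

Lemma Om_not_M z : Om z -> ~ M z.
Proof. by have [y _ ->] := OmC; move=> /connected_component_sub[]. Qed.

Lemma Om_neq0 z : Om (normalize z) -> z != 0.
Proof.
by move=> /Om_sphere/sphere_neq0; apply: contra_neq => ->; rewrite normalize0.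
Qed.

(* The cones over M and Om are the sets [M (normalize z)] and [Om (normalize z)];
   great circle arcs become straight segments avoiding 0. *)
Lemma Om_segment z z' :
  (forall t : R, 0 <= t <= 1 -> z + t *: (z' - z) != 0 /\ ~ M (normalize (z + t *: (z' - z)))) ->
  Om (normalize z) -> Om (normalize z').
Proof.
move=> H Oz.
pose f (t : R) := normalize (z + t *: (z' - z)).
have fc : {within `[0, 1], continuous f}.
  apply: continuous_in_subspaceT => t; rewrite inE /= in_itv /= => t01.
  apply: (@normalize_comp_continuous _ _ _ (fun t : R => z + t *: (z' - z)));
    first exact: (H t t01).1.
  by apply: continuousD; [exact: cst_continuous|exact: scalel_continuous].
have Ac := connected_continuous_connected (@segment_connected R 0 1) fc.
have A0 : (f @` `[0, 1]%classic) (normalize z).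
  by exists 0; rewrite /= ?in_itv /= ?lexx ?ler01// /f scale0r addr0.
have A1 : (f @` `[0, 1]%classic) (normalize z').
  by exists 1; rewrite /= ?in_itv /= ?lexx ?ler01// /f scale1r subrKC.
have [y yS OE] := OmC; move: Oz; rewrite OE => /same_connected_component ->.
apply: connected_component_max A1 => // _ [t + <-]; rewrite /= in_itv /= => t01.
by split; [exact: dot_normalize (H t t01).1|exact: (H t t01).2].
Qed.

Lemma M_far z : z != 0 -> ~ M (normalize z) ->
  exists2 d : R, 0 < d & forall z', `|z' - z| < d -> z' != 0 /\ ~ M (normalize z').
Proof.
move=> z0 zM.
have : \forall z' \near z, z' != 0 /\ ~ M (normalize z').
  have h1 : \forall z' \near z, z' != 0 by exact: near_neq0.
  have h2 : \forall z' \near z, (~` M) (normalize z').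
    apply: (normalize_continuous _ z0); apply: open_nbhs_nbhs; split => //.
    by rewrite openC.
  by apply: filterS2 h1 h2.
by move=> /near_ballP.
Qed.

Lemma Om_ball z : z != 0 -> ~ M (normalize z) ->
  exists2 d : R, 0 < d & forall z', `|z' - z| < d -> (Om (normalize z') <-> Om (normalize z)).
Proof.
move=> z0 zM; have [d d0 H] := M_far z z0 zM; exists d => // z' z'd.
have zd : `|z - z| < d by rewrite subrr normr0.
by split; apply: Om_segment => t t01; apply: H; exact: ball_segment.
Qed.

(** Central projection with t = tan s turns the great circle normal to [M] into a straight line: x +
    t nu and x - t nu are the points of the circle at angle s = atan t, divided by cos s > 0. *)
Lemma inner_line x : M x -> exists2 h : R, 0 < h & forall t, 0 < t -> t < h ->
  Om (normalize (x - t *: nu x)) /\ ~ Om (normalize (x + t *: nu x)).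
Proof.
move=> Mx.
have : \forall t \near (0 : R)^'+, Om (cos t *: x - sin t *: nu x)
  /\ ~ Om (cos t *: x + sin t *: nu x).
  by apply: filterS2 (inner _ Mx) (outer _ Mx).
rewrite near_withinE => /near_ballP[d d0 hd].
have /cvgrPdist_lt/(_ d d0)/near_ballP[h h0 hh] := @continuous_atan R 0.
exists h => // t t0 th.
have ta : 0 < atan t by rewrite -[ltLHS](@atan0 R); exact: lt_atan.
have := hd (atan t) _ ta; rewrite subr0.
have -> : `|atan t| < d.
  by have := hh t; rewrite subr0 gtr0_norm// atan0 sub0r normrN; exact.
have ct : 0 < cos (atan t) by rewrite cos_atan invr_gt0 sqrtr_gt0 ltr_pwDl// sqr_ge0.
have st : sin (atan t) = cos (atan t) * t.
  by rewrite -{3}(@atanK R t) /tan mulrCA mulfV ?mulr1// gt_eqF.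
rewrite st -!scalerA -scalerBr -scalerDr => /(_ isT).
have U s : s = 1 \/ s = -1 -> normalize (x + (s * t) *: nu x) = cos (atan t) *: (x + (s * t)
  *: nu x).
  move=> hs; rewrite -(normalizeZ _ _ ct) normalize_id// dotZl dotZr !dotDl !dotDr !dotZl !dotZr.
  rewrite MS// nu1// nu0// (dotC x) nu0// !mulr0 add0r addr0 mulr1.
  have -> : s * t * (s * t) = t ^+ 2 by case: hs => ->; ring.
  by rewrite mulrA -expr2 cos_atan exprVn sqr_sqrtr ?mulVf// ?gt_eqF// ?ltW// ltr_pwDl// sqr_ge0.
have := U 1 (or_introl erefl); have := U (-1) (or_intror erefl).
by rewrite mulN1r mul1r scaleNr => -> ->.
Qed.

Hypothesis nuc : forall x, M x -> forall e : R, 0 < e ->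
  exists2 d : R, 0 < d & forall y, M y -> `|y - x| < d -> `|nu y - nu x| < e.
Hypothesis Mstrict : forall x, M x -> exists2 d : R, 0 < d &
  forall y z, M y -> M z -> `|y - x| < d -> `|z - x| < d -> y != z -> dot z (nu y) < 0.

Definition nearM x (r : R) y := M y /\ `|y - x| < r.

(* A point z outside the right-hand side can be moved in the direction nu x without
   meeting the cone over M again, and ends on the outer side of M. *)
Lemma local_convex x : M x -> exists r d : R,
  [/\ 0 < r, 0 < d,
   forall y z, nearM x r y -> nearM x r z -> y != z -> dot z (nu y) < 0,
   forall z, `|z - x| < d -> z != 0 /\ `|normalize z - x| < r &
   forall z, `|z - x| < d -> (Om (normalize z) <-> forall y, nearM x r y -> dot z (nu y) < 0)].
Proof.
move=> Mx; set e := nu x.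
have [r1 r10 hconv] := Mstrict x Mx.
(* Near [x] the direction [e] has positive product with every normal, so that moving along it
   increases the product with each of them. *)
have [r2 r20 he] : exists2 r2 : R, 0 < r2 & forall y, M y -> `|y - x| < r2 -> 0 < dot e (nu y).
  have cd : {for e, continuous (fun v : E => dot v e)} by apply: dotl_continuous.
  have /cvgrPdist_lt/(_ 1 ltr01)/near_ballP[d d0 hd] := cd.
  have [r2 r20 hr2] := nuc x Mx d d0.
  exists r2 => // y My yx; have := hd _ (hr2 y My yx).
  by rewrite nu1// dotC ltr_norml => /andP[_]; rewrite ltrBlDr ltrDl.
pose r := Num.min r1 r2.
have r0 : 0 < r by rewrite lt_min r10.
have hc y z : nearM x r y -> nearM x r z -> y != z -> dot z (nu y) < 0.
  by move=> [My]; rewrite lt_min => /andP[y1 _] [Mz]; rewrite lt_min => /andP[z1 _]; exact: hconv.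
have {}he y : nearM x r y -> 0 < dot e (nu y).
  by move=> [My]; rewrite lt_min => /andP[_]; exact: he.
have hxy y : nearM x r y -> dot x (nu y) <= 0.
  move=> Wy; have [->|yx] := eqVneq y x; first by rewrite dotC nu0.
  by apply: ltW; apply: hc => //; split => //; rewrite subrr normr0.
have x0 := sphere_neq0 _ (MS _ Mx).
have [d0 d00 hd0] : exists2 d0 : R, 0 < d0 & forall z, `|z - x| < d0 ->
  z != 0 /\ `|normalize z - x| < r.
  have h1 : \forall z' \near x, z' != 0 by exact: near_neq0.
  have /cvgrPdist_lt/(_ r r0) := normalize_continuous _ x0.
  rewrite normalize_id; last exact: MS.
  move=> h2; apply/near_ballP; apply: filterS2 h1 h2 => z z0; rewrite distrC; by split.
have W z : `|z - x| < d0 -> M (normalize z) -> nearM x r (normalize z).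
  by move=> /hd0[_ zr] Mz.
have notM z y : `|z - x| < d0 -> nearM x r y -> dot z (nu y) > 0 -> ~ M (normalize z).
  move=> zd Wy zy Mz; have Wz := W z zd Mz.
  have [c c0 zE] := normalizeE _ (hd0 z zd).1.
  have : 0 < dot (normalize z) (nu y) by rewrite zE dotZl mulr_gt0.
  apply/negP; rewrite -leNgt; have [->|yz] := eqVneq y (normalize z).
    by rewrite dotC nu0//; case: Wz.
  by apply: ltW; exact: hc.
have [h h0 hin] := inner_line x Mx.
have ne0 : 0 < `|e| + 1 by rewrite ltr_wpDl.
(* Small enough for [inner_line], and for x + t0 e and x - t0 e to stay within d0/2 of [x]. *)
pose t0 := Num.min h (d0 / 2 / (`|e| + 1)) / 2.
have m0 : 0 < Num.min h (d0 / 2 / (`|e| + 1)) by rewrite lt_min h0 !divr_gt0.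
have t00 : 0 < t0 by rewrite divr_gt0.
have t0m : t0 < Num.min h (d0 / 2 / (`|e| + 1)) by rewrite ltr_pdivrMr// ltr_pMr// ltr1n.
have t0h : t0 < h by move: t0m; rewrite lt_min => /andP[].
have t0e : t0 * `|e| < d0 / 2.
  move: t0m; rewrite lt_min => /andP[_]; rewrite ltr_pdivlMr//; apply: le_lt_trans.
  by rewrite ler_wpM2l ?lerDl// ltW.
(* Ensures that z + t0 e lies strictly beyond the tangent hyperplane at [x]. *)
have [d1 d10 hd1] : exists2 d1 : R, 0 < d1 & forall z, `|z - x| < d1 -> `|dot z e| < t0.
  have /cvgrPdist_lt/(_ t0 t00)/near_ballP[d d0' hd] := dotl_continuous e x.
  by exists d => // z /hd; rewrite (dotC x) nu0// sub0r normrN.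
pose d := Num.min (d0 / 2) d1.
have d_gt0 : 0 < d by rewrite lt_min d10 divr_gt0.
have dd0 z : `|z - x| < d -> `|z - x| < d0.
  rewrite lt_min => /andP[+ _] => /lt_trans; apply.
  by rewrite ltr_pdivrMr// ltr_pMr// ltr1n.
exists r, d; split => //; first by move=> z /dd0/hd0.
have xe s : `|s| <= 1 -> `|x + (s * t0) *: e - x| < d0 / 2.
  move=> s1; rewrite addrAC subrr add0r normrZ normrM (gtr0_norm t00); apply: le_lt_trans t0e.
  by rewrite ler_wpM2r// ler_piMl// ltW.
have half u : u < d0 / 2 -> u < d0.
  by move=> /lt_trans; apply; rewrite ltr_pdivrMr// ltr_pMr// ltr1n.
move=> z zd; split; last first.
  (* The segment joins z to the inner point x - t0 e. A point of the cone over [M] on it would have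
     negative product with its own normal, to which it is orthogonal. *)
  move=> zI.
  have cd : `|x - t0 *: e - x| < d0.
    by have := xe (-1); rewrite normrN normr1 lexx mulN1r scaleNr => /(_ isT)/half.
  apply: Om_segment (hin t0 t00 t0h).1 => t t01.
  have wd : `|x - t0 *: e + t *: (z - (x - t0 *: e)) - x| < d0 by apply: ball_segment => //;
    exact: dd0.
  set w := _ + t *: _ in wd *.
  have [w0 wr] := hd0 _ wd; split => // Mw; have Ww := W _ wd Mw.
  have : dot w (nu (normalize w)) < 0.
    move: (nu (normalize w)) (hxy _ Ww) (he _ Ww) (zI _ Ww) => v xv ev zv.
    have -> : w = (1 - t) *: (x - t0 *: e) + t *: z.
      by rewrite /w scalerBr scalerBl scale1r addrA addrAC.
    have c1 : dot (x - t0 *: e) v < 0.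
      by rewrite dotBl dotZl; have := mulr_gt0 t00 ev; lra.
    by rewrite dotDl !dotZl convex_lt0.
  have [c c0 wE] := normalizeE _ w0.
  have := nu0 _ Mw; rewrite dotC {1}wE dotZl => /eqP; rewrite mulf_eq0 gt_eqF//= => /eqP ->.
  by rewrite ltxx.
move=> Oz y Wy; rewrite ltNge; apply/negP => zy.
have z0 := Om_neq0 _ Oz.
have Oz1 : Om (normalize (z + t0 *: e)).
  apply: (Om_segment _ _ _ Oz) => t /andP[t_0 t_1].
  have -> : z + t *: (z + t0 *: e - z) = z + (t * t0) *: e by rewrite addrAC subrr add0r scalerA.
  have wd : `|z + (t * t0) *: e - x| < d0.
    rewrite addrAC; apply: le_lt_trans (ler_normD _ _) _; rewrite [ltRHS]splitr.
    move: zd; rewrite lt_min => /andP[zd _]; apply: ltr_leD => //.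
    have := xe t; rewrite addrAC subrr add0r => /(_ _)/ltW; apply.
    by rewrite ger0_norm.
  split; first exact: (hd0 _ wd).1.
  have [t0'|] := ltP 0 t; last first.
    move=> t_le; have -> : t = 0 by apply/eqP; rewrite eq_le t_le.
    by rewrite mul0r scale0r addr0; exact: Om_not_M.
  apply: (notM _ y) => //; rewrite dotDl dotZl ltr_wpDl//.
  by rewrite mulr_gt0 ?he// mulr_gt0.
have Wx : nearM x r x by split => //; rewrite subrr normr0.
have zh : `|dot z e| < t0 by apply: hd1; move: zd; rewrite lt_min => /andP[].
have hz1 : 0 < dot (z + t0 *: e) e.
  by rewrite dotDl dotZl nu1// mulr1; move: zh; rewrite ltr_norml => /andP[]; lra.
(* Both z + t0 e and the outer point x + t0 e lie strictly beyond the tangent hyperplane at [x]. The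
   segment between them thus misses the cone over [M] and would carry the outer point into [Om]. *)
apply: (hin t0 t00 t0h).2.
apply: Om_segment Oz1 => t t01.
have wd : `|z + t0 *: e + t *: (x + t0 *: e - (z + t0 *: e)) - x| < d0.
  apply: ball_segment => //; last first.
    rewrite addrAC; apply: le_lt_trans (ler_normD _ _) _; rewrite [ltRHS]splitr.
    move: zd; rewrite lt_min => /andP[zd _]; apply: ltrD => //.
    by have := xe 1; rewrite addrAC subrr add0r mul1r normr1 lexx; exact.
  by have := xe 1; rewrite normr1 lexx mul1r => /(_ isT)/half.
split; first exact: (hd0 _ wd).1.
apply: (notM _ x) => //.
rewrite dotDl dotZl dotBl [dot (x + _) _]dotDl dotZl (dotC x) nu0// add0r nu1// mulr1.
by case/andP: t01 => t_0 t_1; nra.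
Qed.


Definition adherent z := forall d : R, 0 < d -> exists2 z', `|z' - z| < d & Om (normalize z').

Lemma adherentP z : z != 0 -> adherent z -> Om (normalize z) \/ M (normalize z).
Proof.
move=> z0 Kz; have [Mz|Mz] := pselect (M (normalize z)); [by right|left].
have [d d0 H] := Om_ball z z0 Mz; have [z' /H zz' Oz'] := Kz d d0.
exact/zz'.
Qed.

Lemma adherentZ c z : 0 < c -> adherent z -> adherent (c *: z).
Proof.
move=> c0 Kz d d0; have [|z' zz' Oz'] := Kz (d / c); first by rewrite divr_gt0.
exists (c *: z'); last by rewrite normalizeZ.
by rewrite -scalerBr normrZ gtr0_norm// mulrC -ltr_pdivlMr.
Qed.

(** The half-space inequality at [x] passes to the closure. A limit point on the tangent hyperplane
    itself is not interior, hence is on the cone over [M], where strictness leaves only the ray of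
    [x]. *)
Lemma adherent_support x : M x -> exists2 d : R, 0 < d &
  forall z, `|z - x| < d -> adherent z ->
    dot z (nu x) <= 0 /\ (dot z (nu x) = 0 -> normalize z = x).
Proof.
move=> Mx; have [r [d [r0 d0 hc hd hO]]] := local_convex x Mx.
have Wx : nearM x r x by split => //; rewrite subrr normr0.
exists d => // z zd Kz; split.
  rewrite leNgt; apply/negP => zx.
  have cd : {for z, continuous (fun v : E => dot v (nu x))} by apply: dotl_continuous.
  have : \forall v \near z, 0 < dot v (nu x) by exact: (cvgr_gt _ cd _ zx).
  move=> /near_ballP[d' d'0 hd'].
  have [|z' zz' Oz'] := Kz (Num.min d' (d - `|z - x|)).
    by rewrite lt_min d'0 subr_gt0.
  move: zz'; rewrite lt_min => /andP[/hd' p1]; rewrite ltrBrDr => p2.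
  have := (hO z' (le_lt_trans (ler_distD z _ _) p2)).1 Oz' x Wx.
  by rewrite ltNge ltW.
move=> zx; have [z0 zr] := hd z zd.
have [Oz|Mz] := adherentP z z0 Kz.
  by have := (hO z zd).1 Oz x Wx; rewrite zx ltxx.
apply/eqP; apply/negPn/negP => /negP; rewrite eq_sym => /negP xz.
have := hc x (normalize z) Wx (conj Mz zr) xz.
by have [c c0 ->] := normalizeE _ z0; rewrite dotZl zx mulr0 ltxx.
Qed.

(** * Visibility from an interior point *)

Section Star.
Variables (p : E).
Hypothesis Op : Om (normalize p).
Hypothesis Np : ~ M (normalize (- p)).

(** Positive multiples are excluded because [p] is interior, negative ones by [Np]. Consequently the
    line through [p] and a point of [M] avoids 0 and projects to the sphere. *)
Lemma p_not_collinear x k : M x -> p != k *: x.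
Proof.
move=> Mx; apply/negP => /eqP pk; have p0 := Om_neq0 _ Op.
have [k0|k0|k0] := ltgtP k 0.
- apply: Np; rewrite pk -scaleNr normalizeZ ?oppr_gt0// normalize_id//; exact: MS.
- by apply: (Om_not_M _ Op); rewrite pk normalizeZ// normalize_id//; exact: MS.
- by move: p0; rewrite pk k0 scale0r eqxx.
Qed.

Lemma ray_neq0 x (s : R) : M x -> x + s *: (p - x) != 0.
Proof.
move=> Mx; apply/negP => /eqP H.
have [s0|s0] := eqVneq s 0.
  by move: H; rewrite s0 scale0r addr0; apply/eqP/sphere_neq0/MS.
have /negP := p_not_collinear x (- s^-1 * (1 - s)) Mx; apply.
apply/eqP; apply: (scalerI s0).
rewrite scalerA; have -> : s * (- s^-1 * (1 - s)) = s - 1 by field.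
by apply/rowP => i; move/rowP/(_ i): H; rewrite !mxE; lra.
Qed.

Definition visible x := forall s : R, 0 < s -> s <= 1 -> Om (normalize (x + s *: (p - x))).

(* If a limit of visible segments met M at an interior point y, it would be tangent
   to M at y while staying in the closure of Om, against [adherent_support]. *)
Lemma visible_closed x : M x ->
  (forall d : R, 0 < d -> exists y, [/\ M y, `|y - x| < d & visible y]) -> visible x.
Proof.
move=> Mx H.
have K s : 0 < s -> s <= 1 -> adherent (x + s *: (p - x)).
  move=> s0 s1 d d0; have [y [My yx Vy]] := H d d0.
  exists (y + s *: (p - y)); last exact: Vy.
  have -> : y + s *: (p - y) - (x + s *: (p - x)) = (1 - s) *: (y - x).
    by apply/rowP => i; rewrite !mxE; ring.
  rewrite normrZ ger0_norm ?subr_ge0//; apply: le_lt_trans yx.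
  by rewrite ler_piMl// lerBlDr lerDl ltW.
move=> s s0 s1.
have [//|My] := adherentP _ (ray_neq0 x s Mx) (K s s0 s1).
have s_lt1 : s < 1.
  rewrite lt_neqAle s1 andbT; apply/eqP => sE; move: My; rewrite sE scale1r subrKC.
  exact: Om_not_M.
set z := x + s *: (p - x) in My.
have z0 : z != 0 := ray_neq0 x s Mx.
have [c c0 yE] := normalizeE _ z0.
set y := normalize z in My yE.
have [d d0 hd] := adherent_support y My.
have dzy : dot z (nu y) = 0.
  have := nu0 _ My; rewrite dotC {1}yE dotZl => /eqP.
  by rewrite mulf_eq0 gt_eqF//= => /eqP.
have nP : 0 < `|p - x| + 1 by rewrite ltr_wpDl.
(* Chosen so that s - h and s + h remain between 0 and 1 and the corresponding points, scaled by
   [c], remain in the ball around [y]. *)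
pose h := Num.min (Num.min s (1 - s)) (d / c / (`|p - x| + 1)) / 2.
have m0 : 0 < Num.min (Num.min s (1 - s)) (d / c / (`|p - x| + 1)).
  by rewrite !lt_min s0 subr_gt0 s_lt1 !divr_gt0.
have h0 : 0 < h by rewrite divr_gt0.
have hm : h < Num.min (Num.min s (1 - s)) (d / c / (`|p - x| + 1)).
  by rewrite ltr_pdivrMr// ltr_pMr// ltr1n.
move: (hm); rewrite !lt_min => /andP[/andP[hs h1s] hd'].
have near_y e : `|e| = h -> `|c *: (x + (s + e) *: (p - x)) - y| < d.
  move=> eh; have -> : c *: (x + (s + e) *: (p - x)) - y = (c * e) *: (p - x).
    by rewrite yE /z -scalerBr scalerDl addrA [_ - _]addrC addKr scalerA.
  rewrite normrZ normrM gtr0_norm// eh -mulrA mulrC -ltr_pdivlMr//.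
  apply: le_lt_trans (_ : h * (`|p - x| + 1) < _); first by rewrite ler_wpM2l ?lerDl// ltW.
  by rewrite -ltr_pdivlMr.
have Kc e : `|e| = h -> adherent (c *: (x + (s + e) *: (p - x))).
  move=> eh; apply: adherentZ => //; apply: K.
    have : `|e| < s by rewrite eh.
    by rewrite ltr_norml => /andP[]; lra.
  have : `|e| < 1 - s by rewrite eh.
  by rewrite ltr_norml => /andP[]; lra.
have dE e : dot (c *: (x + (s + e) *: (p - x))) (nu y) = c * (e * dot (p - x) (nu y)).
  have -> : x + (s + e) *: (p - x) = z + e *: (p - x) by rewrite scalerDl addrA.
  by rewrite dotZl dotDl dzy add0r dotZl.
have hp : `|h| = h by rewrite gtr0_norm.
have hn : `|- h| = h by rewrite normrN.
have [e1 e2] := hd _ (near_y h hp) (Kc h hp).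
have [e3 _] := hd _ (near_y (- h) hn) (Kc (- h) hn).
(* At s + h and s - h the products with [nu y] are opposite and both nonpositive, so the segment
   lies in the tangent hyperplane at [y]. *)
have d0E : dot (p - x) (nu y) = 0.
  move: e1 e3; rewrite !dE !(pmulr_rle0 _ c0) (pmulr_rle0 _ h0) mulNr oppr_le0 (pmulr_rge0 _ h0)
    => a1 a2.
  by apply/eqP; rewrite eq_le a1.
have := e2; rewrite dE d0E !mulr0 => /(_ erefl).
rewrite normalizeZ// => E2; exfalso.
(* Two distinct points of the segment on one ray from 0 would make [p] a multiple of [x]. *)
have [k k0 kE] := normalize_eq _ _ z0 (ray_neq0 x (s + h) Mx) (esym E2).
have hk : (h - (k - 1) * s) *: (p - x) = (k - 1) *: x.
  move: kE; rewrite /z => kE.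
  apply/rowP => i; move/rowP/(_ i): kE; rewrite !mxE => kE; lra.
have [h'0|h'0] := eqVneq (h - (k - 1) * s) 0.
  move: hk; rewrite h'0 scale0r => /esym/eqP;
    rewrite scaler_eq0 (negbTE (sphere_neq0 _ (MS _ Mx))) orbF => /eqP k1.
  by move: h'0; rewrite k1 mul0r subr0 => hE; move: h0; rewrite hE ltxx.
move: (h - _) h'0 hk => q q0 hk.
have /negP := p_not_collinear x (1 + q^-1 * (k - 1)) Mx; apply.
apply/eqP; apply: (scalerI q0); rewrite scalerA.
have -> : q * (1 + q^-1 * (k - 1)) = q + (k - 1) by field.
by rewrite scalerDl -hk -scalerDr subrKC.
Qed.

(** Tube lemma over the compact interval [s1, 1]. Small parameters are excluded because the segment
    starts on [M]; there local convexity takes over. *)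
Lemma visible_tube x (s1 : R) : M x -> 0 < s1 -> visible x ->
  exists2 d : R, 0 < d & forall y, `|y - x| < d -> forall s : R, s1 <= s -> s <= 1 ->
    Om (normalize (y + s *: (p - y))).
Proof.
move=> Mx s10 Vx.
have : \forall y \near x, `[s1, 1]%classic `<=` [set s | Om (normalize (y + s *: (p - y)))].
  have /compact_near_coveringP cov := @segment_compact R s1 1.
  apply: (cov _ (nbhs x) (fun y => [set s | Om (normalize (y + s *: (p - y)))])).
  move=> s; rewrite /= in_itv /= => /andP[ss1 s_1].
  have Os := Vx s (lt_le_trans s10 ss1) s_1.
  have [d d0 hd] := Om_ball _ (ray_neq0 x s Mx) (Om_not_M _ Os).
  have cf : {for (s, x), continuous (fun sy : R * E => sy.2 + sy.1 *: (p - sy.2))}.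
    apply: continuousD; first exact: cvg_snd.
    apply: continuousZ; first exact: cvg_fst.
    by apply: continuousB; [exact: cvg_cst|exact: cvg_snd].
  have /cvgrPdist_lt/(_ d d0) := cf.
  apply: filterS => -[s' y] /=; rewrite distrC => /hd h; exact/h.
move=> /near_ballP[d d0 hd]; exists d => // y yd s ss1 s_1.
by apply: (hd y yd); rewrite /= in_itv /= ss1.
Qed.

(** Beyond the parameter [s1] this is [visible_tube]. Before it the segment stays where [Om] is an
    intersection of open half-spaces: it starts in the closed half-spaces and ends in the open ones,
    so all later points are in the open ones. *)
Lemma visible_open x : M x -> visible x ->
  exists2 d : R, 0 < d & forall y, M y -> `|y - x| < d -> visible y.
Proof.
move=> Mx Vx; have [r [d [r0 d0 hc hd hO]]] := local_convex x Mx.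
have nP : 0 < `|p - x| + 1 by rewrite ltr_wpDl.
pose s1 := Num.min 1 (d / 2 / (`|p - x| + 1)) / 2.
have m0 : 0 < Num.min 1 (d / 2 / (`|p - x| + 1)) by rewrite lt_min ltr01 !divr_gt0.
have s10 : 0 < s1 by rewrite divr_gt0.
have s1m : s1 < Num.min 1 (d / 2 / (`|p - x| + 1)) by rewrite ltr_pdivrMr// ltr_pMr// ltr1n.
move: s1m; rewrite lt_min => /andP[s1_1 s1d].
have {}s1d : s1 * `|p - x| < d / 2.
  apply: le_lt_trans (_ : s1 * (`|p - x| + 1) < _); first by rewrite ler_wpM2l ?lerDl// ltW.
  by rewrite -ltr_pdivlMr.
clearbody s1; have [dt dt0 ht] := visible_tube x s1 Mx s10 Vx.
exists (Num.min (Num.min r (d / 2)) dt); first by rewrite !lt_min r0 dt0 divr_gt0.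
move=> y My; rewrite !lt_min => /andP[/andP[yr yd2] ydt] s s0 s_1.
have [ss|ss] := leP s1 s; first exact: ht.
have Oc := ht y ydt s1 (lexx _) (ltW s1_1).
have cd : `|y + s1 *: (p - y) - x| < d.
  have -> : y + s1 *: (p - y) - x = (1 - s1) *: (y - x) + s1 *: (p - x).
    by apply/rowP => i; rewrite !mxE; ring.
  apply: le_lt_trans (ler_normD _ _) _; rewrite [ltRHS]splitr !normrZ.
  rewrite ltrD ?(gtr0_norm s10)// ger0_norm ?subr_ge0 ?(ltW s1_1)//.
  by apply: le_lt_trans yd2; rewrite ler_piMl// lerBlDr lerDl ltW.
have yd : `|y - x| < d by apply: lt_trans yd2 _; rewrite ltr_pdivrMr// ltr_pMr// ltr1n.
have t01 : 0 <= s / s1 <= 1 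
  by apply/andP; split; [rewrite divr_ge0// ltW|rewrite ler_pdivrMr// mul1r ltW].
have E1 : y + s *: (p - y) = y + (s / s1) *: (y + s1 *: (p - y) - y).
  by rewrite [y + _ - y]addrC addKr scalerA divfK// gt_eqF.
have zd : `|y + s *: (p - y) - x| < d by rewrite E1; apply: ball_segment.
apply/(hO _ zd) => w Ww.
have cw := (hO _ cd).1 Oc w Ww.
have yw : dot y (nu w) <= 0.
  have [->|wy] := eqVneq w y; first by rewrite dotC nu0.
  by apply: ltW; exact: hc.
rewrite E1; have -> : y + (s / s1) *: (y + s1 *: (p - y) - y) = (1 - s / s1) *: y + (s / s1)
  *: (y + s1 *: (p - y)).
  by rewrite scalerBr scalerBl scale1r addrA addrAC.
rewrite dotDl 2!dotZl ltr_wnDl//; first by rewrite mulr_ge0_le0// subr_ge0; case/andP: t01.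
by rewrite pmulr_rlt0// divr_gt0.
Qed.

(** Points of the segment close to [x] are interior, hence strictly inside the half-space at [x]. As
    [x] is orthogonal to [nu x], their sign is that of [p]. *)
Lemma visible_support x : M x -> visible x -> dot p (nu x) < 0.
Proof.
move=> Mx Vx; have [r [d [r0 d0 hc hd hO]]] := local_convex x Mx.
have nP : 0 < `|p - x| + 1 by rewrite ltr_wpDl.
pose s := Num.min 1 (d / (`|p - x| + 1)) / 2.
have m0 : 0 < Num.min 1 (d / (`|p - x| + 1)) by rewrite lt_min ltr01 !divr_gt0.
have s0 : 0 < s by rewrite divr_gt0.
have : s < Num.min 1 (d / (`|p - x| + 1)) by rewrite ltr_pdivrMr// ltr_pMr// ltr1n.
rewrite lt_min => /andP[s_1 sd].
have zd : `|x + s *: (p - x) - x| < d.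
  rewrite addrAC subrr add0r normrZ (gtr0_norm s0).
  apply: le_lt_trans (_ : s * (`|p - x| + 1) < _); first by rewrite ler_wpM2l ?lerDl// ltW.
  by rewrite -ltr_pdivlMr.
have Wx : nearM x r x by split => //; rewrite subrr normr0.
have := (hO _ zd).1 (Vx s s0 (ltW s_1)) x Wx.
by rewrite dotDl dotZl dotBl (dotC x) nu0// subr0 add0r pmulr_rlt0.
Qed.

End Star.

(** * From visibility to injectivity *)

Hypothesis Mconn : connected M.

(** The base point p lies on the inner normal at [x], so [x] is visible from p and starts the
    induction along the connected set [M]. *)
Lemma star_shaped x : M x -> exists2 h : R, 0 < h & forall t, 0 < t -> t < h ->
  ~ M (normalize (- (x - t *: nu x))) -> forall y, M y ->
  visible (x - t *: nu x) y /\ dot (x - t *: nu x) (nu y) < 0.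
Proof.
move=> Mx; have [h h0 hin] := inner_line x Mx; exists h => // t t0 th.
set p := x - t *: nu x => Np.
have Op : Om (normalize p) := (hin t t0 th).1.
have V : forall y, M y -> visible p y.
  apply: (@connected_ind R _ M (visible p) Mconn).
  - exists x => // s s0 s1.
    have -> : x + s *: (p - x) = x - (s * t) *: nu x.
      by rewrite /p addrAC subrr add0r scalerN scalerA.
    apply: (hin _ _ _).1; first by rewrite mulr_gt0.
    by apply: le_lt_trans th; rewrite ler_piMl// ltW.
  - by move=> y My Vy; exact: visible_open.
  - by move=> y My H; exact: visible_closed.
by move=> y My; split; [exact: V|apply: visible_support => //; exact: V].
Qed.

(* Otherwise M would contain a geodesic arc starting at -x. *)
Lemma antipode_free x (h : R) : M x -> 0 < h ->
  exists t, [/\ 0 < t, t < h & ~ M (normalize (- (x - t *: nu x)))].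
Proof.
move=> Mx h0; apply: contrapT => H.
have HM t : 0 < t -> t < h -> M (normalize (- x + t *: nu x)).
  move=> t0 th; apply: contrapT => H'; apply: H; exists t; split => //.
  by rewrite opprB addrC.
have x0 := sphere_neq0 _ (MS _ Mx).
have nx0 : - x != 0 by rewrite oppr_eq0.
have ne0 : 0 < `|nu x| + 1 by rewrite ltr_wpDl.
have small (d : R) : 0 < d -> exists t : R, [/\ 0 < t, t < h & forall s : R, 0 <= s -> s <= t ->
  `|- x + s *: nu x - - x| < d].
  move=> d0; pose m := Num.min h (d / (`|nu x| + 1)).
  have m0 : 0 < m by rewrite lt_min h0 divr_gt0.
  have mm : m / 2 < m by rewrite ltr_pdivrMr// ltr_pMr// ltr1n.
  exists (m / 2); split; first by rewrite divr_gt0.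
    by apply: lt_le_trans mm _; rewrite /m ge_min lexx.
  move=> s s0 sm; rewrite addrAC subrr add0r normrZ ger0_norm//.
  apply: le_lt_trans (_ : s * (`|nu x| + 1) < _); first by rewrite ler_wpM2l ?lerDl.
  rewrite -ltr_pdivlMr//; apply: le_lt_trans sm (lt_le_trans mm _).
  by rewrite /m ge_min lexx orbT.
have Mnx : M (- x).
  have -> : - x = normalize (- x) by rewrite normalize_id// dotNl dotNr opprK; exact: MS.
  apply: contrapT => Nx; have [d d0 hd] := M_far _ nx0 Nx.
  have [t [t0 th /(_ t (ltW t0) (lexx _)) td]] := small d d0.
  by have [_] := hd _ td; apply; exact: HM.
have [d d0 hd] := Mstrict _ Mnx.
have [d' d'0 hd'] : exists2 d' : R, 0 < d' & forall z, `|z - - x| < d' -> `|normalize z - - x| < d.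
  have /cvgrPdist_lt/(_ d d0) := normalize_continuous _ nx0.
  rewrite [normalize (- x)]normalize_id; last by rewrite dotNl dotNr opprK; exact: MS.
  by move=> /near_ballP[d' d'0 h']; exists d' => // z /h'; rewrite distrC.
have [t [t0 th tn]] := small d' d'0.
pose w s : E := - x + s *: nu x.
have t20 : 0 < t / 2 by rewrite divr_gt0.
have t2 : t / 2 < t by rewrite ltr_pdivrMr// ltr_pMr// ltr1n.
have wM s : 0 <= s -> s <= t -> M (normalize (w s)) /\ `|normalize (w s) - - x| < d.
  move=> s0 st; split; last exact/hd'/tn.
  have [->|sn0] := eqVneq s 0.
    by rewrite /w scale0r addr0 normalize_id// dotNl dotNr opprK; exact: MS.
  by apply: HM; [rewrite lt_neqAle eq_sym sn0|exact: le_lt_trans th].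
have wn0 s : w s != 0.
  apply/negP => /eqP/(congr1 (dot x)); rewrite dot0r dotDr dotNr MS// dotZr dotC nu0//.
  by rewrite mulr0 addr0 => /eqP; rewrite oppr_eq0 oner_eq0.
have winj s s' : normalize (w s) = normalize (w s') -> s = s'.
  move=> /(normalize_eq _ _ (wn0 s) (wn0 s'))[k k0 E1].
  have := congr1 (dot x) E1; rewrite dotZr !dotDr !dotNr MS// !dotZr dotC nu0// !mulr0 !addr0.
  rewrite mulrN mulr1 => /oppr_inj kE.
  have := congr1 (dot (nu x)) E1; rewrite -kE scale1r !dotDr !dotNr nu0// !dotZr nu1//.
  by rewrite !mulr1 oppr0 !add0r.
have [M1 n1] := wM (t / 2) (ltW t20) (ltW t2).
have [M0 n0] := wM 0 (lexx _) (ltW t0).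
have [M2 n2] := wM t (ltW t0) (lexx _).
(* The product of [w s] with the normal at the middle point is affine in s and vanishes at s = t/2,
   yet strictness would make it negative at both s = 0 and s = t. *)
have sgn s : s != t / 2 -> M (normalize (w s)) -> `|normalize (w s) - - x| < d -> dot (w s)
  (nu (normalize (w (t / 2)))) < 0.
  move=> st Ms ns; have : dot (normalize (w s)) (nu (normalize (w (t / 2)))) < 0.
    by apply: hd => //; apply/eqP => /winj/esym/eqP; exact/negP.
  have [c c0 ->] := normalizeE _ (wn0 s); rewrite dotZl pmulr_rlt0//.
have := sgn 0 _ M0 n0; rewrite lt_eqF// => /(_ isT).
have := sgn t _ M2 n2; rewrite gt_eqF// => /(_ isT).
have := nu0 _ M1; rewrite dotC; have [c c0 {1}->] := normalizeE _ (wn0 (t / 2)).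
rewrite dotZl => /eqP; rewrite mulf_eq0 gt_eqF//= => /eqP.
rewrite /w !dotDl !dotZl mul0r addr0; lra.
Qed.

(** Letting p = y - t nu y tend to [y] turns the strict inequality of [star_shaped] into a weak one;
    [antipode_free] supplies admissible t below any bound. *)
Lemma gauss_support x y : M x -> M y -> dot y (nu x) <= 0.
Proof.
move=> Mx My; rewrite leNgt; apply/negP => yx.
have [h h0 hs] := star_shaped y My.
have ne0 : 0 < `|dot (nu y) (nu x)| + 1 by rewrite ltr_wpDl.
have [|t [t0 + Nt]] := antipode_free y (Num.min h (dot y (nu x) / (`|dot (nu y) (nu x)| + 1))) My.
  by rewrite lt_min h0 divr_gt0.
rewrite lt_min => /andP[th tb].
have [_] := hs t t0 th Nt x Mx; rewrite dotBl dotZl.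
move: tb; rewrite ltr_pdivlMr// => tb.
have := ler_norm (t * dot (nu y) (nu x)); rewrite normrM (gtr0_norm t0).
by move: tb; rewrite mulrDr mulr1; lra.
Qed.

Hypothesis Mperfect : forall x, M x -> forall d : R, 0 < d ->
  exists z, [/\ M z, z != x & `|z - x| < d].

(** With equal normals [y] lies on the tangent hyperplane at [x], and the segment from [x] to [y] in
    the closure of the cone over [Om]. By [adherent_support] its points near [x] lie on the ray of
    [x], which leaves y = x or y = -x. *)
Theorem gauss_injective x y : M x -> M y -> nu x = nu y -> x = y.
Proof.
move=> Mx My nuE; apply/eqP/negPn/negP => xy.
have x0 := sphere_neq0 _ (MS _ Mx).
(* If -x were on [M], [gauss_support] would give each normal a nonnegative product with x, against
   strictness at a second point z of [M] close to x. *)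
have ny : y != - x.
  apply/negP => /eqP yx; have [d d0 hd] := Mstrict _ Mx.
  have [z [Mz zx zd]] := Mperfect x Mx d d0.
  have := hd z x Mz Mx zd; rewrite subrr normr0 => /(_ d0 zx).
  have := gauss_support z y Mz My; rewrite yx dotNl oppr_le0.
  by rewrite leNgt => /negP.
have [d d0 hd] := adherent_support x Mx.
have [d' d'0 hd'] : exists2 d' : R, 0 < d' & forall z, `|z - x| < d' -> z != 0.
  by apply/near_ballP; exact: near_neq0.
have nP : 0 < `|y - x| + 1 by rewrite ltr_wpDl.
pose m := Num.min 1 (Num.min d d' / (`|y - x| + 1)).
have m0 : 0 < m by rewrite lt_min ltr01 divr_gt0// lt_min d0.
pose s := m / 2.
have s0 : 0 < s by rewrite divr_gt0.
have sm : s < m by rewrite ltr_pdivrMr// ltr_pMr// ltr1n.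
move: (sm); rewrite lt_min => /andP[s1 sd].
pose z := x + s *: (y - x).
have zx : `|z - x| < Num.min d d'.
  rewrite /z addrAC subrr add0r normrZ (gtr0_norm s0).
  apply: le_lt_trans (_ : s * (`|y - x| + 1) < _); first by rewrite ler_wpM2l ?lerDl// ltW.
  by rewrite -ltr_pdivlMr.
move: zx; rewrite lt_min => /andP[zd zd'].
(* At fixed s the point z is the limit, as t tends to 0, of points on the segments from [x] to y - t
   nu y, all of which are interior. *)
clearbody s; have Kz : adherent z.
  move=> e e0; have [h h0 hs] := star_shaped y My.
  have ne0 : 0 < `|nu y| + 1 by rewrite ltr_wpDl.
  have [|t [t0 + Nt]] := antipode_free y (Num.min h (e / (`|nu y| + 1))) My.
    by rewrite lt_min h0 divr_gt0.
  rewrite lt_min => /andP[th te].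
  have [V _] := hs t t0 th Nt x Mx.
  exists (x + s *: (y - t *: nu y - x)); last by apply: V => //; exact: ltW.
  have -> : x + s *: (y - t *: nu y - x) - z = - ((s * t) *: nu y).
    by apply/rowP => i; rewrite !mxE; ring.
  rewrite normrN normrZ gtr0_norm ?mulr_gt0//.
  apply: le_lt_trans (_ : t * (`|nu y| + 1) < _); last by rewrite -ltr_pdivlMr.
  rewrite ler_pM ?mulr_ge0// ?(ltW s0) ?(ltW t0)//; last by rewrite lerDl.
  by rewrite ler_piMl// ltW.
have [_] := hd z zd Kz; rewrite dotDl dotZl dotBl !(dotC _ (nu x)) nu0// nuE nu0//.
rewrite subr0 mulr0 addr0 => /(_ erefl) zE.
have [k k0 kE] := normalize_eq _ _ x0 (hd' z zd') (etrans (normalize_id _ (MS _ Mx)) (esym zE)).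
have yE : y = (1 + s^-1 * (k - 1)) *: x.
  apply: (scalerI (lt0r_neq0 s0)); rewrite scalerA mulrDr mulr1 mulrA mulfV ?mul1r ?gt_eqF//.
  move: kE; rewrite /z => kE.
  by apply/rowP => i; move/rowP/(_ i): kE; rewrite !mxE; lra.
have := MS _ My; rewrite yE dotZl dotZr MS// mulr1 -expr2 => /eqP.
rewrite sqrf_eq1 => /orP[/eqP kk|/eqP kk]; move: yE; rewrite kk ?scale1r ?scaleN1r => yE.
  by move: xy; rewrite yE eqxx.
by move: ny; rewrite yE eqxx.
Qed.

End Global.

(** * Regularity of the normal and of the dual hypersurface *)

Section VectorCalculus.
Context {R : realType} {a : R} (ha : 0 <= a <= 1).

Lemma derive_basis_row {N P} (f : 'rV[R]_N -> 'rV[R]_P) x v : differentiable f x ->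
  'D_v f x = \sum_i v 0 i *: 'D_(delta_mx 0 i) f x.
Proof.
move=> df; rewrite deriveE// {1}(row_sum_delta v) linear_sum.
by apply: eq_bigr => i _; rewrite linearZ deriveE.
Qed.

Lemma derive_comp {N P Q} (f : 'rV[R]_P -> 'rV[R]_Q) (g : 'rV[R]_N -> 'rV[R]_P) x v :
  differentiable g x -> differentiable f (g x) ->
  'D_v (fun y => f (g y)) x = 'D_('D_v g x) f (g x).
Proof.
move=> dg df; have dfg : differentiable (f \o g) x by exact: differentiable_comp.
by rewrite (deriveE _ df) (deriveE _ dg) (deriveE _ dfg) diff_comp.
Qed.

Lemma derive_dot {N P} (f g : 'rV[R]_N -> 'rV[R]_P) x v :
  differentiable f x -> differentiable g x ->
  'D_v (fun u => dot (f u) (g u)) x = dot ('D_v f x) (g x) + dot (f x) ('D_v g x).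
Proof.
move=> df dg.
have dfi i : derivable (fun u => f u 0 i) x v.
  by apply/diff_derivable; exact: (row_differentiableP f x).1 df i.
have dgi i : derivable (fun u => g u 0 i) x v.
  by apply/diff_derivable; exact: (row_differentiableP g x).1 dg i.
have -> : (fun u => dot (f u) (g u)) = \sum_i ((fun u => f u 0 i) * (fun u => g u 0 i)).
  by apply/funext => u; rewrite fct_sumE.
rewrite derive_sum; last by move=> i; exact: derivableM.
rewrite -big_split /=; apply: eq_bigr => i _.
rewrite deriveM// !derive_row// /GRing.scale /= addrC; congr (_ + _).
by rewrite mulrC.
Qed.

Lemma differentiable_dot {N P} (f g : 'rV[R]_N -> 'rV[R]_P) x :
  differentiable f x -> differentiable g x -> differentiable (fun u => dot (f u) (g u)) x.
Proof.
move=> df dg.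
have -> : (fun u => dot (f u) (g u)) = \sum_i ((fun u => f u 0 i) * (fun u => g u 0 i)).
  by apply/funext => u; rewrite fct_sumE.
apply: differentiable_sum => i; apply: differentiableM.
  exact: (row_differentiableP f x).1 df i.
exact: (row_differentiableP g x).1 dg i.
Qed.

Lemma derive_dotl {N P} (f : 'rV[R]_N -> 'rV[R]_P) c x v : differentiable f x ->
  'D_v (fun u => dot (f u) c) x = dot ('D_v f x) c.
Proof.
move=> df; rewrite (derive_dot f (fun=> c))//.
by rewrite derive_cst dot0r addr0.
Qed.

Lemma Ck_dot {N P k} {U : set 'rV[R]_N} (f g : 'rV[R]_N -> 'rV[R]_P) : open U ->
  (forall i, Ck k a U (fun u => f u 0 i)) -> (forall i, Ck k a U (fun u => g u 0 i)) ->
  Ck k a U (fun u => dot (f u) (g u)).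
Proof. by move=> Uo fC gC; apply: Ck_sum => // i _; exact: Ck_mul. Qed.

Lemma Ck_normalize {N P k} {U : set 'rV[R]_N} (f : 'rV[R]_N -> 'rV[R]_P) i : open U ->
  (forall u, U u -> f u != 0) ->
  (forall i, Ck k a U (fun u => f u 0 i)) -> Ck k a U (fun u => normalize (f u) 0 i).
Proof.
move=> Uo f0 fC.
apply: (Ck_ext (fun u => (Num.sqrt (dot (f u) (f u)))^-1 * f u 0 i)) => // [u _|];
  first by rewrite mxE.
apply: Ck_mul => //; apply: Ck_inv => // [u Uu|].
  by rewrite gt_eqF// sqrtr_gt0 dot_gt0 f0.
by apply: Ck_sqrt => // [u Uu|]; [rewrite dot_gt0 f0|exact: Ck_dot].
Qed.

(** Applied to the normal and to the derivative of the dual parametrisation. Only the equation is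
    needed: no regularity of the solution is presupposed. *)
Lemma Ck_solve {N p k} {U : set 'rV[R]_N} (A : 'rV[R]_N -> 'M[R]_p) (b z : 'rV[R]_N -> 'rV[R]_p) j :
  open U -> (forall u, U u -> A u \in unitmx) ->
  (forall i j, Ck k a U (fun u => A u i j)) -> (forall i, Ck k a U (fun u => b u 0 i)) ->
  (forall u, U u -> z u *m A u = b u) -> Ck k a U (fun u => z u 0 j).
Proof.
move=> Uo Au AC bC zE.
apply: (Ck_ext (fun u => \sum_i b u 0 i * invmx (A u) i j)) => // [u Uu|].
  by rewrite -[z u](mulmxK (Au u Uu)) zE// mxE.
by apply: Ck_sum => // i _; apply: Ck_mul => //; exact: Ck_invmx.
Qed.

Lemma Ck_dim0 {N k} {U : set 'rV[R]_N} f : N = 0%N -> Ck k a U f.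
Proof.
move=> N0; subst N.
have -> : f = (fun=> f 0) by apply/funext => x; rewrite [x]thinmx0.
exact: Ck_cst.
Qed.

Lemma near_det_neq0 {N p} {U : set 'rV[R]_N} (A : 'rV[R]_N -> 'M[R]_p) u0 : open U -> U u0 ->
  (forall i j, Ck 0 a U (fun u => A u i j)) -> A u0 \in unitmx ->
  exists2 d : R, 0 < d & forall u, `|u - u0| < d -> U u /\ A u \in unitmx.
Proof.
move=> Uo Uu0 AC; rewrite unitmxE unitfE => A0.
have cd := Ck_cont (Ck_det ha _ Uo AC) Uu0.
have h : \forall u \near u0, \det (A u) != 0 by exact: (cvgr_neq0 _ cd A0).
have h' : \forall u \near u0, U u by exact: open_nbhs_nbhs.
suff : \forall u \near u0, U u /\ A u \in unitmx by move=> /near_ballP.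
by apply: filterS2 h' h => u Uu du; rewrite unitmxE unitfE.
Qed.

End VectorCalculus.

(** * Linear systems adapted to a tangent space *)

Section Frame.
Context {R : realType} {n : nat}.
Implicit Types (x e v : 'rV[R]_n.+2) (J : 'M[R]_(n, n.+2)).

(* The square matrix with rows x, e and the rows of J; written with [unlift]
   because a block matrix would have 2 + n instead of n.+2 rows. *)
Definition frame x e J : 'M[R]_n.+2 :=
  \matrix_(i < n.+2) (if unlift ord0 i is Some j
    then if unlift ord0 j is Some k then row k J else e else x).

Lemma frame0 x e J : row ord0 (frame x e J) = x.
Proof. by rewrite rowK unlift_none. Qed.

Lemma frame1 x e J : row (lift ord0 ord0) (frame x e J) = e.
Proof. by rewrite rowK liftK unlift_none. Qed.

Lemma frame2 x e J i : row (lift ord0 (lift ord0 i)) (frame x e J) = row i J.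
Proof. by rewrite rowK !liftK. Qed.

Lemma frame_ind (P : 'I_n.+2 -> Prop) : P ord0 -> P (lift ord0 ord0) ->
  (forall i, P (lift ord0 (lift ord0 i))) -> forall i, P i.
Proof.
move=> P0 P1 P2 i; case: (unliftP ord0 i) => [j|] -> //.
by case: (unliftP ord0 j) => [k|] -> //.
Qed.

Lemma mul_frameE v x e J i : (v *m (frame x e J)^T) 0 i = dot v (row i (frame x e J)).
Proof. by rewrite mxE; apply: eq_bigr => j _; rewrite !mxE. Qed.

(** In a vanishing combination of the rows, the products with [x] and [e] kill their own
    coefficients, and independence of the rows of [J] kills the others. The transpose is used
    because multiplying by it lists the products with the rows. *)
Lemma frame_unit x e J : dot x x = 1 -> dot e e = 1 -> dot x e = 0 ->
  (forall i, dot x (row i J) = 0) -> (forall i, dot e (row i J) = 0) ->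
  (forall c : 'rV[R]_n, c *m J = 0 -> c = 0) -> (frame x e J)^T \in unitmx.
Proof.
move=> xx ee xe xJ eJ Jinj; rewrite unitmx_tr; apply: mulmx_inj_unit => c.
pose c2 : 'rV[R]_n := \row_i c 0 (lift ord0 (lift ord0 i)).
have -> : c *m frame x e J = c 0 ord0 *: x + c 0 (lift ord0 ord0) *: e + c2 *m J.
  rewrite mulmx_sum_row !big_ord_recl frame0 frame1 addrA; congr (_ + _).
  by rewrite mulmx_sum_row; apply: eq_bigr => i _; rewrite frame2 mxE.
have dJ y : (forall i, dot y (row i J) = 0) -> dot y (c2 *m J) = 0.
  move=> yJ; rewrite mulmx_sum_row /dot.
  transitivity (\sum_i c2 0 i * dot y (row i J)); last by rewrite big1// => i _; rewrite yJ mulr0.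
  under [RHS]eq_bigr do rewrite /dot mulr_sumr.
  rewrite [RHS]exchange_big; apply: eq_bigr => j _; rewrite summxE mulr_sumr.
  by apply: eq_bigr => i _; rewrite !mxE mulrCA.
move=> E; have c0 : c 0 ord0 = 0.
  have := congr1 (dot x) E; rewrite !dotDr !dotZr xx xe dJ// dot0r; lra.
have c1 : c 0 (lift ord0 ord0) = 0.
  have := congr1 (dot e) E; rewrite !dotDr !dotZr ee dotC xe dJ// dot0r; lra.
move: E; rewrite c0 c1 !scale0r !add0r => /Jinj c20.
apply/rowP; apply: frame_ind => [||i]; rewrite mxE//.
by have /rowP/(_ i) := c20; rewrite !mxE.
Qed.

Lemma frame_eq0 x e J v : (frame x e J)^T \in unitmx -> dot v x = 0 -> dot v e = 0 ->
  (forall i, dot v (row i J) = 0) -> v = 0.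
Proof.
move=> Fu vx ve vJ; apply: (can_inj (mulmxK Fu)); rewrite mul0mx.
by apply/rowP; apply: frame_ind => [||i]; rewrite mul_frameE ?frame0 ?frame1 ?frame2 mxE.
Qed.

Lemma frame_Ck {a : R} {N k} {U : set 'rV[R]_N} (x e : 'rV[R]_N -> 'rV[R]_n.+2) (J : 'rV[R]_N ->
  'M[R]_(n, n.+2)) :
  open U -> (forall j, Ck k a U (fun u => x u 0 j)) -> (forall j, Ck k a U (fun u => e u 0 j)) ->
  (forall i j, Ck k a U (fun u => J u i j)) ->
  forall i j, Ck k a U (fun u => (frame (x u) (e u) (J u))^T i j).
Proof.
move=> Uo xC eC JC i j; move: j; apply: frame_ind => [||j].
- by apply: Ck_ext (xC i) => // u _; rewrite !mxE unlift_none.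
- by apply: Ck_ext (eC i) => // u _; rewrite !mxE liftK unlift_none.
- by apply: Ck_ext (JC j i) => // u _; rewrite !mxE !liftK mxE.
Qed.

End Frame.

(** * Normal and strict convexity in one chart *)

Section Chart.
Context {R : realType} {a : R} (ha : 0 <= a <= 1) {n k : nat}.
Variables (M : set 'rV[R]_n.+2) (nu : 'rV[R]_n.+2 -> 'rV[R]_n.+2).
Hypothesis MS : forall x, M x -> dot x x = 1.
Hypothesis hnu : forall x, M x -> unit_normal k.+2 a M x (nu x).
Hypothesis hconv : second_form_posdef k.+2 a M (fun x => - nu x).
Variables (U : set 'rV[R]_n) (phi : 'rV[R]_n -> 'rV[R]_n.+2).
Hypothesis hc : chart k.+2 a M U phi.

Lemma chart_open : open U. Proof. by case: hc. Qed.
Let Uo := chart_open.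

Lemma chart_Ck i : Ck k.+2 a U (fun u => phi u 0 i).
Proof. by case: hc => _ /(class_CP _ Uo). Qed.

Lemma chart_diff u : U u -> differentiable phi u.
Proof. by move=> Uu; apply/row_differentiableP => i; exact: Ck_diff (chart_Ck i) Uu. Qed.

Lemma chart_D_Ck v i : Ck k.+1 a U (fun u => 'D_v phi u 0 i).
Proof.
apply: Ck_ext (Ck_D v (chart_Ck i)) => // u Uu.
by rewrite derive_row//; exact: chart_diff.
Qed.

Lemma chart_D_diff v u : U u -> differentiable ('D_v phi) u.
Proof. by move=> Uu; apply/row_differentiableP => i; exact: Ck_diff (chart_D_Ck v i) Uu. Qed.

Lemma chart_DD_Ck v w i : Ck k a U (fun u => 'D_v ('D_w phi) u 0 i).
Proof.
apply: Ck_ext (Ck_D v (chart_D_Ck w i)) => // u Uu.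
by rewrite derive_row//; exact: chart_D_diff.
Qed.

Lemma chart_M u : U u -> M (phi u).
Proof.
move=> Uu; have [_ _ _ [V [psi [_ E _ _ _]]]] := hc.
have : (phi @` U) (phi u) by exists u.
by rewrite E => -[].
Qed.

Lemma chart_inj u v : U u -> U v -> phi u = phi v -> u = v.
Proof.
move=> Uu Uv E; have [_ _ _ [V [psi [_ _ _ _ H]]]] := hc.
by rewrite -(H u Uu) E H.
Qed.

(** Continuity of the inverse of the chart on a relatively open piece of [M]. It turns statements
    about parameters near [u0] into statements about all of [M] near [phi u0]. *)
Lemma chart_near u0 (r : R) : U u0 -> 0 < r -> exists2 d : R, 0 < d &
  forall y, M y -> `|y - phi u0| < d -> exists u, [/\ U u, `|u - u0| < r & phi u = y].
Proof.
move=> Uu0 r0; have [_ _ _ [V [psi [Vo E _ cpsi H]]]] := hc.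
have MV : (M `&` V) (phi u0) by rewrite -E; exists u0.
have [d d0 hd] := open_ballP Vo MV.2.
have := (subspace_continuousP _ _).1 cpsi _ MV.
move=> /cvgrPdist_lt/(_ r r0); rewrite near_withinE => /near_ballP[d' d'0 hd'].
exists (Num.min d d'); first by rewrite lt_min d0.
move=> y My; rewrite lt_min => /andP[/hd Vy /hd'].
have MVy : (M `&` V) y by [].
move=> /(_ MVy) h; move: (MVy); rewrite -E => -[u Uu uy].
have {}h : `|psi (phi u0) - psi y| < r := h.
by exists u; split => //; move: h; rewrite -uy !H// distrC.
Qed.

Lemma sphere_D u v : U u -> dot (phi u) ('D_v phi u) = 0.
Proof.
move=> Uu; have dphi := chart_diff u Uu.
have : 'D_v (fun u => dot (phi u) (phi u)) u = 0.
  rewrite -(derive_cst (1 : R) u v); apply: near_eq_derive.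
  by apply: (near_eq_on _ Uo Uu) => w Uw; rewrite MS//; exact: chart_M.
by rewrite derive_dot// dotC; lra.
Qed.

Lemma normal_unit u : U u -> dot (nu (phi u)) (nu (phi u)) = 1.
Proof. by move=> /chart_M/hnu[]. Qed.

Lemma normal_pos u : U u -> dot (nu (phi u)) (phi u) = 0.
Proof. by move=> /chart_M/hnu[]. Qed.

Lemma normal_D u v : U u -> dot (nu (phi u)) ('D_v phi u) = 0.
Proof.
move=> Uu; have [_ _] := hnu _ (chart_M u Uu); apply; exists U, phi, u, v; split => //.
by rewrite deriveE//; exact: chart_diff.
Qed.

Lemma normal_DD u v : U u -> v != 0 -> dot ('D_v ('D_v phi) u) (nu (phi u)) < 0.
Proof.
by move=> Uu v0; have := hconv U phi hc u v Uu v0; rewrite /second_form dotNr oppr_gt0.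
Qed.

Lemma row_jac u i : U u -> row i (jac phi u) = 'D_(delta_mx 0 i) phi u.
Proof.
move=> Uu; apply/rowP => j; rewrite !mxE derive_row//; exact: chart_diff.
Qed.

Lemma jac_Ck i j : Ck k.+1 a U (fun u => jac phi u i j).
Proof. by apply: Ck_ext (Ck_D (delta_mx 0 i) (chart_Ck j)) => // u _; rewrite mxE. Qed.

Lemma jac_inj u (c : 'rV[R]_n) : U u -> c *m jac phi u = 0 -> c = 0.
Proof.
move=> Uu; have [_ _ dI _] := hc; rewrite -derive_jac; last exact: chart_diff.
rewrite deriveE; last exact: chart_diff.
by rewrite -(linear0 ('d phi u)) => /dI; exact.
Qed.

Lemma frame_chart_unit u : U u -> (frame (phi u) (nu (phi u)) (jac phi u))^T \in unitmx.
Proof.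
move=> Uu; apply: frame_unit.
- exact/MS/chart_M.
- exact: normal_unit.
- by rewrite dotC normal_pos.
- by move=> i; rewrite row_jac// sphere_D.
- by move=> i; rewrite row_jac// normal_D.
- by move=> c; exact: jac_inj.
Qed.

(* The unnormalised normal is fixed by its product with the reference normal, hence
   solves a linear system with coefficients of class C^(k+1); its orientation is
   the one that makes the second fundamental form negative. *)
Lemma normal_Ck u0 : U u0 -> exists2 d : R, 0 < d &
  (forall u, `|u - u0| < d -> U u) /\
  forall j, Ck k.+1 a [set u | `|u - u0| < d] (fun u => nu (phi u) 0 j).
Proof.
move=> Uu0; have [d0 d00 dU] := open_ballP Uo Uu0.
(* Functions on a zero-dimensional space are constant; a direction for testing the sign exists only
   for [n] > 0. *)
have [n0|n0] := posnP n.
  by exists d0 => //; split => // j; exact: Ck_dim0.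
set e := nu (phi u0).
have phiC i : Ck k.+1 a U (fun u => phi u 0 i) by apply: (Ck_le ha Uo _ (chart_Ck i)).
pose A u := (frame (phi u) e (jac phi u))^T.
have AC i j : Ck k.+1 a U (fun u => A u i j).
  by apply: frame_Ck => //; [move=> ?; exact: Ck_cst|exact: jac_Ck].
have Au0 : A u0 \in unitmx by exact: frame_chart_unit.
have AC0 i j : Ck 0 a U (fun u => A u i j) by apply: (Ck_le ha Uo _ (AC i j)).
have [d d_gt0 dA] := near_det_neq0 ha A u0 Uo Uu0 AC0 Au0.
pose B := [set u | `|u - u0| < d].
have Bo : open B by exact: open_ball_norm.
have BU u : B u -> U u by move=> /dA[].
have BA u : B u -> A u \in unitmx by move=> /dA[].
have Bu0 : B u0 by rewrite /B /= subrr normr0.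
pose al u := dot (nu (phi u)) e.
(* Otherwise the normal would be orthogonal to all rows of an invertible matrix. *)
have al0 u : B u -> al u != 0.
  move=> Bu; apply/eqP => al0; have Uu := BU u Bu.
  have : nu (phi u) = 0.
    apply: (frame_eq0 _ _ _ _ (BA u Bu)) => //; first exact: normal_pos.
    by move=> i; rewrite row_jac// normal_D.
  by apply/eqP/sphere_neq0/normal_unit.
pose N u := (al u)^-1 *: nu (phi u).
pose b : 'rV[R]_n.+2 := delta_mx 0 (lift ord0 ord0).
have NC j : Ck k.+1 a B (fun u => N u 0 j).
  apply: (Ck_solve ha A (fun=> b) N j Bo BA).
  - by move=> i j'; apply: Ck_sub (AC i j').
  - by move=> i; exact: Ck_cst.
  move=> u Bu; have Uu := BU u Bu; apply/rowP; apply: frame_ind => [||i];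
    rewrite mul_frameE ?frame0 ?frame1 ?frame2 mxE dotZl.
  - by rewrite normal_pos// mulr0.
  - by rewrite mulVf ?al0// !eqxx.
  - by rewrite row_jac// normal_D// mulr0.
have Nu0 : N u0 = e by rewrite /N /al normal_unit// invr1 scale1r.
pose v : 'rV[R]_n := delta_mx 0 (Ordinal n0).
have v0 : v != 0.
  by apply/eqP => /rowP/(_ (Ordinal n0)); rewrite !mxE !eqxx; apply/eqP/oner_neq0.
have sC : Ck 0 a B (fun u => dot ('D_v ('D_v phi) u) (N u)).
  apply: Ck_dot => // i; last by apply: (Ck_le ha Bo _ (NC i)).
  by apply: Ck_sub BU _; apply: (Ck_le ha Uo _ (chart_DD_Ck v v i)).
have h0 : dot ('D_v ('D_v phi) u0) (N u0) < 0 by rewrite Nu0; exact: normal_DD.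
have : \forall u \near u0, dot ('D_v ('D_v phi) u) (N u) < 0.
  exact: (cvgr_lt _ (Ck_cont sC Bu0) _ h0).
move=> /near_ballP[d' d'0 hd'].
exists (Num.min d d'); first by rewrite lt_min d_gt0.
split=> [u|j]; first by rewrite lt_min => /andP[/dA[]].
set B' := [set u | _].
have B'B : B' `<=` B by move=> u; rewrite /B' /= lt_min => /andP[].
have B'o : open B' by exact: open_ball_norm.
have N0 u : B' u -> N u != 0.
  move=> /B'B Bu; rewrite scaler_eq0 negb_or invr_eq0 al0//=.
  exact/sphere_neq0/normal_unit/BU.
apply: (Ck_ext (fun u => normalize (N u) 0 j)) => // [u B'u|]; last first.
  by apply: Ck_normalize => // i; apply: Ck_sub (NC i).
have Bu := B'B u B'u; have Uu := BU u Bu.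
(* The second derivative has negative product with both [N u] and the true normal, so the factor
   relating them is positive. *)
have al_gt0 : 0 < (al u)^-1.
  have : dot ('D_v ('D_v phi) u) (N u) < 0.
    by apply: hd'; move: B'u; rewrite /B' /= lt_min => /andP[].
  by rewrite dotZr => H; have := normal_DD u v Uu v0 => H'; rewrite -(nmulr_llt0 _ H').
by rewrite normalizeZ// normalize_id//; exact: normal_unit.
Qed.

(** Derivative and normal are taken at different points because the Taylor remainder in
    [chart_support] is evaluated away from the point of the normal. Negativity at [u0] spreads
    uniformly over the compact unit sphere of directions; homogeneity covers the rest. *)
Lemma second_form_neg u0 : U u0 -> exists2 d : R, 0 < d &
  forall u w v, `|u - u0| < d -> `|w - u0| < d -> v != 0 ->
    dot ('D_v ('D_v phi) w) (nu (phi u)) < 0.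
Proof.
move=> Uu0; have [d d0 [dU NC]] := normal_Ck u0 Uu0.
pose c i j (w u : 'rV[R]_n) := dot ('D_(delta_mx 0 i) ('D_(delta_mx 0 j) phi) w) (nu (phi u)).
have DE v w u : U w -> dot ('D_v ('D_v phi) w) (nu (phi u))
  = \sum_i v 0 i * \sum_j v 0 j * c i j w u.
  move=> Uw; rewrite derive_basis_row; last exact: chart_D_diff.
  have S (F : 'I_n -> 'rV[R]_n.+2) y : dot (\sum_i v 0 i *: F i) y = \sum_i v 0 i * dot (F i) y.
    elim/big_ind2: _ => [|_ s1 _ s2 <- <-|i _];
      [by rewrite dot0l|by rewrite dotDl|by rewrite dotZl].
  rewrite S; apply: eq_bigr => i _; congr (_ * _).
  rewrite -S; congr (dot _ _).
  have -> : 'D_(delta_mx 0 i) ('D_v phi) w = 'D_(delta_mx 0 i) (\sum_j v 0 j *: 'D_(delta_mx 0 j)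
    phi) w.
    apply: near_eq_derive; apply: (near_eq_on _ Uo Uw) => w' Uw'.
    by rewrite fct_sumE derive_basis_row//; exact: chart_diff.
  have dD j : derivable ('D_(delta_mx 0 j) phi) w (delta_mx 0 i).
    by apply: diff_derivable; exact: chart_D_diff.
  rewrite derive_sum; last by move=> j; exact: derivableZ.
  by apply: eq_bigr => j _; rewrite deriveZ.
pose K := [set v : 'rV[R]_n | `|v| = 1].
have Kc : compact K.
  apply: (subclosed_compact _ (closed_ball_compact 0 1)).
    have -> : K = (fun v => `|v|) @^-1` [set 1] by [].
    by apply: closed_comp; [move=> y _; exact: norm_continuous|exact: closed_eq].
  by move=> v; rewrite /K /= subr0 => ->.
pose q (x : 'rV[R]_n * ('rV[R]_n * 'rV[R]_n)) :=
  \sum_i x.1 0 i * \sum_j x.1 0 j * c i j x.2.1 x.2.2.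
have cc i j : {for (u0, u0), continuous (fun x : 'rV[R]_n * 'rV[R]_n => c i j x.1 x.2)}.
  apply: dot_continuous.
    apply: (@continuous_comp _ _ _ fst ('D_(delta_mx 0 i) ('D_(delta_mx 0 j) phi)));
      first exact: cvg_fst.
    by apply/row_continuousP => l; exact: Ck_cont (chart_DD_Ck _ _ l) Uu0.
  apply: (@continuous_comp _ _ _ snd (fun u => nu (phi u))); first exact: cvg_snd.
  by apply/row_continuousP => l; apply: Ck_cont (NC l) _; rewrite /= subrr normr0.
have qc v : {for (v, (u0, u0)), continuous q}.
  apply: cvg_big => [|i _]; first exact: add_continuous.
  have cv l : {for (v, (u0, u0)), continuous (fun x : 'rV[R]_n * ('rV[R]_n * 'rV[R]_n) => x.1 0 l)}.
    apply: (@continuous_comp _ _ _ fst (fun v : 'rV[R]_n => v 0 l)); first exact: cvg_fst.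
    exact: coord_continuous.
  apply: cvgM; first exact: cv.
  apply: cvg_big => [|j _]; first exact: add_continuous.
  apply: cvgM; first exact: cv.
  by apply: (@continuous_comp _ _ _ snd (fun x : 'rV[R]_n * 'rV[R]_n => c i j x.1 x.2));
    [exact: cvg_snd|exact: cc].
have : \forall x \near (u0, u0), K `<=` [set v | q (v, x) < 0].
  have /compact_near_coveringP cov := Kc.
  apply: (cov _ (nbhs (u0, u0)) (fun x => [set v | q (v, x) < 0])) => v Kv.
  have v0 : v != 0 by rewrite -normr_gt0 Kv.
  have q0 : q (v, (u0, u0)) < 0 by rewrite /q /= -DE//; exact: normal_DD.
  have h : \forall x \near (v, (u0, u0)), q x < 0 by exact: (cvgr_lt _ (qc v) _ q0).
  by move: h; apply: filterS => -[].
move=> [[P Q] /= [/near_ballP[d1 d10 h1] /near_ballP[d2 d20 h2]] hPQ].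
exists (Num.min d (Num.min d1 d2)); first by rewrite !lt_min d0 d10.
move=> u w v; rewrite !lt_min => /and3P[ud u1 u2] /and3P[wd w1 w2] v0.
have Kv : K (`|v|^-1 *: v) by rewrite /K /= normrZ normfV normr_id mulVf// normr_eq0.
have := hPQ (w, u) (conj (h1 _ w1) (h2 _ u2)) _ Kv; rewrite /= /q /=.
rewrite DE; last exact: dU.
have iv0 : 0 < `|v|^-1 by rewrite invr_gt0 normr_gt0.
have -> : \sum_i (`|v|^-1 *: v) 0 i * \sum_j (`|v|^-1 *: v) 0 j * c i j w u =
   `|v|^-1 * (`|v|^-1 * \sum_i v 0 i * \sum_j v 0 j * c i j w u).
  rewrite !mulr_sumr; apply: eq_bigr => i _; rewrite mxE -!mulrA; congr (_ * _).
  rewrite [in RHS]mulrCA; congr (_ * _); rewrite mulr_sumr; apply: eq_bigr => j _.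
  by rewrite mxE mulrA.
by rewrite !pmulr_rlt0.
Qed.


(** Taylor expansion by two mean value steps: the terms of order 0 and 1 vanish because the normal
    is orthogonal to position and tangent vectors, and the remainder is a positive multiple of a
    second derivative paired with the normal. *)
Lemma chart_support u0 : U u0 -> exists2 d : R, 0 < d &
  forall y z, M y -> M z -> `|y - phi u0| < d -> `|z - phi u0| < d -> y != z ->
    dot z (nu y) < 0.
Proof.
move=> Uu0; have [d1 d10 h1] := second_form_neg u0 Uu0.
have [d2 d20 h2] := open_ballP Uo Uu0.
have r0 : 0 < Num.min d1 d2 by rewrite lt_min d10.
have [d d0 hd] := chart_near u0 _ Uu0 r0; exists d => // y z My Mz yd zd.
have [u [Uu ur <-]] := hd y My yd; have [u' [Uu' ur' <-]] := hd z Mz zd => uu'.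
pose v := u' - u.
have v0 : v != 0 by rewrite subr_eq0; apply: contra_neq uu' => ->.
set c := nu (phi u).
have seg (t : R) : 0 <= t <= 1 -> `|u + t *: v - u0| < d1 /\ U (u + t *: v).
  move=> t01; have := ball_segment t ur' ur t01.
  by rewrite lt_min => /andP[? /h2 ?].
have [|t /andP[t0 t1]] := MVT_line (fun w => dot (phi w) c) u v.
  by move=> t /seg[_ Uw]; apply: differentiable_dot => //; exact: chart_diff.
have tt : 0 <= t <= 1 by rewrite !ltW.
rewrite subrKC [X in _ - X](dotC _ c) normal_pos// subr0 derive_dotl; last by apply: chart_diff;
  exact: (seg t tt).2.
have st01 (s : R) : 0 <= s <= 1 -> 0 <= s * t <= 1.
  by move=> /andP[s0 s1]; rewrite mulr_ge0 ?(ltW t0)//= mulr_ile1 ?(ltW t0) ?(ltW t1).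
have [|s /andP[s0 s1]] := MVT_line (fun w => dot ('D_v phi w) c) u (t *: v).
  move=> s s01; rewrite scalerA; have [] := seg (s * t) (st01 s s01).
  by move=> _ Uw; apply: differentiable_dot => //; exact: chart_D_diff.
have [|sd Us] := seg (s * t).
  by apply: st01; rewrite !ltW.
have D1 : dot ('D_v phi u) c = 0 by rewrite dotC; exact: normal_D.
rewrite scalerA D1 subr0 => E.
have dw : differentiable ('D_v phi) (u + (s * t) *: v) by exact: chart_D_diff.
have D2 : 'D_(t *: v) (fun w => dot ('D_v phi w) c) (u + (s * t) *: v) =
    t * dot ('D_v ('D_v phi) (u + (s * t) *: v)) c.
  rewrite (derive_dotl ('D_v phi) c _ _ dw) deriveE// linearZ -deriveE//.
  by rewrite dotZl.
rewrite dotC => ->; rewrite E D2 pmulr_rlt0//.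
by apply: h1 => //; move: ur; rewrite lt_min => /andP[].
Qed.

Lemma normal_continuous u0 (e : R) : U u0 -> 0 < e -> exists2 d : R, 0 < d &
  forall y, M y -> `|y - phi u0| < d -> `|nu y - nu (phi u0)| < e.
Proof.
move=> Uu0 e0; have [r r0 [_ NC]] := normal_Ck u0 Uu0.
have cN : {for u0, continuous (fun u => nu (phi u))}.
  by apply/row_continuousP => j; apply: Ck_cont (NC j) _; rewrite /= subrr normr0.
have /cvgrPdist_lt/(_ e e0)/near_ballP[s s0 hs] := cN.
have [d d0 hd] := chart_near u0 s Uu0 s0; exists d => // y My yd.
by have [u [Uu us <-]] := hd y My yd; rewrite distrC; exact: hs.
Qed.

Lemma chart_not_isolated u0 (d : R) : (0 < n)%N -> U u0 -> 0 < d ->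
  exists z, [/\ M z, z != phi u0 & `|z - phi u0| < d].
Proof.
move=> n0 Uu0 d0; have [r r0 hr] := open_ballP Uo Uu0.
have /cvgrPdist_lt/(_ d d0)/near_ballP[s s0 hs] := differentiable_continuous (chart_diff u0 Uu0).
pose v : 'rV[R]_n := const_mx (Num.min r s / 2).
have m0 : 0 < Num.min r s by rewrite lt_min r0.
have vE : `|v| < Num.min r s.
  apply: le_lt_trans (_ : Num.min r s / 2 < _); last by rewrite ltr_pdivrMr// ltr_pMr// ltr1n.
  apply: norm_row_le => [|i]; first by rewrite divr_ge0// ltW.
  by rewrite mxE gtr0_norm// divr_gt0.
have v0 : v != 0.
  apply/eqP => /rowP/(_ (Ordinal n0)); rewrite !mxE => /eqP.
  by rewrite gt_eqF// divr_gt0.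
have uv : `|u0 + v - u0| < Num.min r s by rewrite addrAC subrr add0r.
move: uv; rewrite lt_min => /andP[/hr Uv /hs vd].
exists (phi (u0 + v)); split; first exact: chart_M.
  apply/eqP => /(chart_inj _ _ Uv Uu0)/eqP; rewrite -subr_eq0 addrAC subrr add0r.
  exact/negP.
by rewrite distrC.
Qed.

(** * A chart of the image *)

Section DualChart.
Hypothesis Mc : compact M.
Hypothesis nuc : forall x, M x -> forall e : R, 0 < e ->
  exists2 d : R, 0 < d & forall y, M y -> `|y - x| < d -> `|nu y - nu x| < e.
Hypothesis inj : forall x y, M x -> M y -> nu x = nu y -> x = y.

(* [pr] is the projection to the tangent space at u0, and [G] the Gauss map
   projected there, with local inverse [H]. *)
Lemma dual_chart u0 : U u0 -> exists (W : set 'rV[R]_n) (Phi : 'rV[R]_n -> 'rV[R]_n.+2),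
  chart k.+2 a (nu @` M) W Phi /\ (Phi @` W) (nu (phi u0)).
Proof.
move=> Uu0; have [r r0 [BU NC]] := normal_Ck u0 Uu0.
set B0 := [set u | `|u - u0| < r] in NC.
have B0o : open B0 by exact: open_ball_norm.
have B0u0 : B0 u0 by rewrite /B0 /= subrr normr0.
pose N u := nu (phi u).
have dN u : B0 u -> differentiable N u.
  by move=> Bu; apply/row_differentiableP => i; exact: Ck_diff (NC i) Bu.
pose J := jac phi u0.
pose pr (y : 'rV[R]_n.+2) : 'rV[R]_n := y *m J^T.
have prE y i : pr y 0 i = dot y (row i J).
  by rewrite mxE; apply: eq_bigr => j _; rewrite !mxE.
pose G u := pr (N u).
have GC j : Ck k.+1 a B0 (fun u => G u 0 j).
  apply: (Ck_ext (fun u => dot (N u) (row j J))) => // [u _|]; first by rewrite /G prE.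
  by apply: Ck_dot => // i; exact: Ck_cst.
(* If the derivative of [G] along v vanished, that of [N] would be orthogonal to the tangent space;
   differentiating <N, D_v phi> = 0 would then give <N, D_v D_v phi> = 0, against definiteness. *)
have JG : jac G u0 \in unitmx.
  apply: mulmx_inj_unit => v; rewrite -derive_jac; last first.
    by apply/row_differentiableP => j; exact: Ck_diff (GC j) B0u0.
  move=> D0; apply/eqP/negPn/negP => v0.
  have Di i : dot ('D_v N u0) (row i J) = 0.
    have /rowP/(_ i) := D0; rewrite derive_row; last first.
      by apply/row_differentiableP => j; exact: Ck_diff (GC j) B0u0.
    rewrite (_ : (fun u => G u 0 i) = (fun u => dot (N u) (row i J))); last first.
      by apply/funext => u; rewrite /G prE.
    by rewrite derive_dotl ?mxE//; exact: dN.
  have D1 : dot ('D_v N u0) ('D_v phi u0) = 0.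
    rewrite (derive_jac phi u0 v (chart_diff u0 Uu0)).
    rewrite mulmx_sum_row dot_sumr big1// => i _; by rewrite dotZr Di mulr0.
  have : 'D_v (fun u => dot (N u) ('D_v phi u)) u0 = 0.
    rewrite -(derive_cst (0 : R) u0 v); apply: near_eq_derive.
    by apply: (near_eq_on _ B0o B0u0) => w Bw; rewrite normal_D//; exact: BU.
  rewrite derive_dot; [|exact: dN|exact: chart_D_diff].
  rewrite D1 add0r dotC; apply/eqP; rewrite lt_eqF//; exact: normal_DD.
have [B [H [Bo Bu0 BB0 [Wo HG HC]]]] := local_inverse ha G u0 B0o B0u0 GC JG.
set W := G @` B in Wo HC.
have HB w : W w -> B (H w) by move=> [u Bu <-]; rewrite HG.
have GH w : W w -> G (H w) = w by move=> [u Bu <-]; rewrite HG.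
have HU w : W w -> U (H w) by move=> /HB/BB0/BU.
have dH w : W w -> differentiable H w.
  by move=> Ww; apply/row_differentiableP => i; exact: Ck_diff (HC i) Ww.
have mk : maxn k.+1 1 = k.+1 by rewrite (maxn_idPl _).
have PhiC j : Ck k.+1 a W (fun w => N (H w) 0 j).
  apply: (Ck_comp ha (fun u => N u 0 j) H Wo B0o) => [w /HB/BB0//||i]; first exact: NC.
  by rewrite mk.
have posC j : Ck k.+1 a W (fun w => phi (H w) 0 j).
  apply: (Ck_comp ha (fun u => phi u 0 j) H Wo Uo HU); last by move=> i; rewrite mk.
  by apply: (Ck_le ha Uo _ (chart_Ck j)).
(* Position and normal vary, but the rows [J] stay those at [u0], to match the projection [pr]; the
   matrix remains invertible near the base point. *)
pose A w := (frame (phi (H w)) (N (H w)) J)^T.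
have AC i j : Ck k.+1 a W (fun w => A w i j).
  by apply: frame_Ck => // i' j'; exact: Ck_cst.
have Ww0 : W (G u0) by exists u0.
have A0 : A (G u0) \in unitmx by rewrite /A HG//; exact: frame_chart_unit.
have AC0 i j : Ck 0 a W (fun w => A w i j) by apply: (Ck_le ha Wo _ (AC i j)).
have [d d0 dA] := near_det_neq0 ha A (G u0) Wo Ww0 AC0 A0.
pose W' := [set w | `|w - G u0| < d].
have W'o : open W' by exact: open_ball_norm.
have W'W : W' `<=` W by move=> w /dA[].
have W'A w : W' w -> A w \in unitmx by move=> /dA[].
have W'0 : W' (G u0) by rewrite /W' /= subrr normr0.
pose Phi w := N (H w).
have PhiC' j : Ck k.+1 a W' (fun w => Phi w 0 j) by apply: Ck_sub W'W _; exact: PhiC.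
have dPhi w : W' w -> differentiable Phi w.
  by move=> Ww; apply/row_differentiableP => i; exact: Ck_diff (PhiC' i) Ww.
have prPhi w : W w -> pr (Phi w) = w by move=> Ww; rewrite /Phi -[RHS]GH.
(* [Phi] is a section of the linear map [pr], which makes these products constant in w. *)
have DJ w v i : W' w -> dot ('D_v Phi w) (row i J) = v 0 i.
  move=> W'w; rewrite -derive_dotl; last exact: dPhi.
  rewrite -[v in RHS](derive_id w) derive_row//.
  apply: near_eq_derive; apply: (near_eq_on _ W'o W'w) => w' W'w'.
  by rewrite -prE prPhi//; exact: W'W.
have DP w v : W' w -> dot ('D_v Phi w) (Phi w) = 0.
  move=> W'w; have : 'D_v (fun w => dot (Phi w) (Phi w)) w = 0.
    rewrite -(derive_cst (1 : R) w v); apply: near_eq_derive.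
    by apply: (near_eq_on _ W'o W'w) => w' W'w'; rewrite normal_unit//; apply: HU; exact: W'W.
  rewrite (derive_dot Phi Phi w v (dPhi w W'w) (dPhi w W'w)) [X in _ + X]dotC; lra.
have Dx w v : W' w -> dot ('D_v Phi w) (phi (H w)) = 0.
  move=> W'w; have Ww := W'W w W'w; set u := H w; have Uu : U u := HU w Ww.
  have B0u : B0 u := BB0 _ (HB w Ww).
  have -> : 'D_v Phi w = 'D_('D_v H w) N u.
    exact: (derive_comp N H w v (dH w Ww) (dN u B0u)).
  have : 'D_('D_v H w) (fun u => dot (N u) (phi u)) u = 0.
    rewrite -(derive_cst (0 : R) u ('D_v H w)); apply: near_eq_derive.
    by apply: (near_eq_on _ B0o B0u) => w' Bw'; rewrite normal_pos//; exact: BU.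
  by rewrite (derive_dot N phi u _ (dN u B0u) (chart_diff u Uu)) normal_D// addr0.
have PhiCC j : Ck k.+2 a W' (fun w => Phi w 0 j).
  apply: Ck_succ => [w W'w|v]; first exact: Ck_diff (PhiC' j) W'w.
  (* The products of the derivative with position, normal and tangent basis are 0, 0 and v. With
     this constant right-hand side the derivative inherits the class of the matrix. *)
  pose b : 'rV[R]_n.+2 := \row_i (if unlift ord0 i is Some i' then
     if unlift ord0 i' is Some l then v 0 l else 0 else 0).
  apply: (Ck_ext (fun w => 'D_v Phi w 0 j)) => // [w W'w|]; first exact: derive_row (dPhi w W'w).
  apply: (Ck_solve ha A (fun=> b) ('D_v Phi) j W'o W'A).
  - by move=> i j'; apply: Ck_sub W'W _; exact: AC.
  - by move=> i; exact: Ck_cst.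
  move=> w W'w; apply/rowP; apply: frame_ind => [||i];
    rewrite mul_frameE ?frame0 ?frame1 ?frame2 mxE ?liftK ?unlift_none.
  - exact: Dx.
  - exact: DP.
  - exact: DJ.
exists W', Phi; split; last first.
  by exists (G u0) => //; rewrite /Phi HG.
pose B' := [set u | B u /\ W' (G u)].
have BM u : B u -> U u by move=> /BB0/BU.
have GB u : B u -> {for u, continuous G}.
  by move=> Bu; apply/row_continuousP => j; apply: Ck_cont (GC j) _; exact: BB0.
(* The part of [M] outside the new chart. It is compact, so its image is closed and can be removed
   from the ambient space. *)
pose C := M `\` (phi @` B').
have Cc : compact C.
  apply: subclosed_compact Mc _; last by move=> y [].
  rewrite -openC; apply: open_ballI => y Cy.
  have [My|My] := pselect (M y); last first.
    have Mo : open (~` M) by rewrite openC; apply: compact_closed => //; exact: norm_hausdorff.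
    by have [s s0 hs] := open_ballP Mo My; exists s => // z /hs nM [Mz _]; exact: nM.
  have [u [Bu W'u] uy] : (phi @` B') y by apply: contrapT => H1; apply: Cy.
  have : \forall v \near u, B v /\ W' (G v).
    have h1 : \forall v \near u, B v by exact: open_nbhs_nbhs.
    have h2 : \forall v \near u, W' (G v) by apply: (GB u Bu); exact: open_nbhs_nbhs.
    by apply: filterS2 h1 h2.
  move=> /near_ballP[s s0 hs].
  have [t t0 ht] := chart_near u s (BM u Bu) s0.
  exists t => // z zt [Mz]; apply; rewrite -uy in zt.
  by have [v [_ vs vz]] := ht z Mz zt; exists v => //; exact: hs.
have Cnu : closed (nu @` C).
  apply: compact_closed; first exact: norm_hausdorff.
  apply: continuous_compact Cc; apply/subspace_continuousP => x [Mx Nx].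
  apply/cvgrPdist_lt => e e0; rewrite near_withinE.
  have [s s0 hs] := nuc x Mx e e0.
  have xs : \forall y \near x, `|y - x| < s by apply/near_ballP; exists s.
  apply: filterS xs => y ys [My _]; rewrite distrC; exact: hs.
split => //.
- by apply/(class_CP _ W'o).
(* The linear map [pr] is a left inverse of the differential. *)
- move=> w W'w v v' vv'; apply/rowP => i.
  by rewrite -!(DJ w _ i W'w) !deriveE ?vv'//; exact: dPhi.
(* Injectivity of the Gauss map keeps the values of [Phi] on [W'] off the removed set; the inverse
   [pr] is linear and defined everywhere. *)
exists (~` (nu @` C)), pr; split.
- by rewrite openC.
- apply/seteqP; split => [_ [w W'w <-]|_ [[y My <-] Cy]].
    have Uw := HU w (W'W w W'w); split; first by exists (phi (H w)) => //; exact: chart_M.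
    move=> [y [My Ny] /inj yE]; apply: Ny; rewrite yE//; last exact: chart_M.
    exists (H w) => //; split; first exact: HB (W'W w W'w).
    by rewrite GH//; exact: W'W.
  have [u [Bu W'u] uy] : (phi @` B') y by apply: contrapT => H1; apply: Cy; exists y.
  by exists (G u) => //; rewrite /Phi HG// /N uy.
- apply: continuous_in_subspaceT => w; rewrite inE => W'w.
  by apply: differentiable_continuous; exact: dPhi.
- apply: continuous_subspaceT => y; apply/row_continuousP => i.
  rewrite (_ : (fun y => pr y 0 i) = (fun y => dot y (row i J))); last by apply/funext => z;
    rewrite prE.
  exact: dotl_continuous.
- by move=> w /W'W; exact: prPhi.
Qed.

End DualChart.

End Chart.

Theorem theorem2p6 (R : realType) (n m : nat) (a : R)
    (hm : (2 <= m)%N) (ha : 0 <= a <= 1)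
    (M : set 'rV[R]_n.+2)
    (hM : hypersurface m a M) (Mclosed : compact M) (Mconn : connected M)
    (Om : set 'rV[R]_n.+2) (hOm : side M Om)
    (nu : 'rV[R]_n.+2 -> 'rV[R]_n.+2) (hnu : gauss_map m a M Om nu)
    (Mconvex : second_form_posdef m a M (fun x => - nu x)) :
  hypersurface m a (nu @` M).
Proof.
case: m hm hM hnu Mconvex => [|[|k]]// _ [MS Mch] hnu hconv.
have nuN x : M x -> unit_normal k.+2 a M x (nu x) by move=> /hnu[].
have nuc x : M x -> forall e : R, 0 < e -> exists2 d : R, 0 < d &
    forall y, M y -> `|y - x| < d -> `|nu y - nu x| < e.
  move=> Mx e e0; have [U [phi [hc [u Uu <-]]]] := Mch x Mx.
  exact: (normal_continuous ha M nu MS nuN hconv U phi hc u e Uu e0).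
have inj x y : M x -> M y -> nu x = nu y -> x = y.
  (* For [n] = 0 a chart covers a single point, so every point of [M] is isolated and connectedness
     leaves at most one. *)
  have [n0|n0] := posnP n.
    move=> Mx My _; suff : forall z, M z -> z = x by move=> H; rewrite (H y My).
    apply: (@connected_ind R _ M (fun z => z = x) Mconn); first by exists x.
      move=> z Mz ->; have [U [phi [hc [u Uu ux]]]] := Mch x Mx.
      have [d d0 hd] := chart_near M U phi hc u 1 Uu ltr01.
      exists d => // w Mw; rewrite -ux => wd; have [v [_ _ <-]] := hd w Mw wd.
      by congr phi; apply/rowP => i; exfalso; case: i; rewrite n0.
    move=> z Mz H; apply/eqP; rewrite -subr_eq0 -normr_le0.
    apply/ler_addgt0Pl => e e0; rewrite addr0 distrC.
    by have [w [_ wz <-]] := H e e0; rewrite ltW.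
  have Mcl : closed M by apply: compact_closed => //; exact: norm_hausdorff.
  apply: (@gauss_injective R n.+2 M Om nu) => //.
  - by move=> z /nuN[].
  - by move=> z /nuN[].
  - by move=> z /hnu[].
  - by move=> z /hnu[].
  - move=> z Mz; have [U [phi [hc [u Uu <-]]]] := Mch z Mz.
    exact: (chart_support ha M nu MS nuN hconv U phi hc u Uu).
  - move=> z Mz d d0; have [U [phi [hc [u Uu <-]]]] := Mch z Mz.
    exact: (chart_not_isolated M U phi hc u d n0 Uu d0).
split=> [_ [x Mx <-]|_ [x Mx <-]]; first by case: (nuN x Mx).
have [U [phi [hc [u Uu <-]]]] := Mch x Mx.
exact: (dual_chart ha M nu MS nuN hconv U phi hc Mclosed nuc inj u Uu).
Qed.
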